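(* Let $T>0$, let $m\ge 1$, let $\alpha_0>\alpha_1>\cdots>\alpha_m\ge 0$ be real numbers, and let $n_i$ be the nonnegative integer with $n_i-1<\alpha_i\le n_i$ ($i=0,\dots,m$). Consider the equation $${}^cD_{0+}^{\alpha_0}y(t)=-\sum_{i=1}^m a_i(t)\,{}^cD_{0+}^{\alpha_i}y(t),\qquad 0<t<T.\tag{E}$$ Assume that $n_0>n_1$, that $a_i\in C[0,T]$ for $i=1,\dots,m$, and that $H_0\ne\emptyset$, where $H_j=\{i\in\{1,\dots,m\}:0\le\alpha_i\le j\}$ (so that every $H_j$ is nonempty); put $h_j=\min H_j$. Then there exists a unique canonical fundamental system $y_j\in C^{\alpha_0,n_0-1}[0,T]$, $j=0,1,\dots,n_0-1$, of solutions of (E), and it is given by $$y_j(t)=\Phi_{j+1}(t)+\sum_{k=0}^\infty(-1)^{k+1}I_{0+}^{\alpha_0}\Big[\sum_{i=1}^m a_i(t)I_{0+}^{\alpha_0-\alpha_i}\Big]^k\sum_{i=h_j}^m a_i(t)\Phi_{j+1-\alpha_i}(t),\qquad j=0,1,\dots,n_1-1,$$ $$y_j(t)=\Phi_{j+1}(t)+\sum_{k=0}^\infty(-1)^{k+1}I_{0+}^{\alpha_0}\Big[\sum_{i=1}^m a_i(t)I_{0+}^{\alpha_0-\alpha_i}\Big]^k\sum_{i=1}^m a_i(t)\Phi_{j+1-\alpha_i}(t),\qquad j=n_1,n_1+1,\dots,n_0-1.$$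
   Context: All functions are real valued. Riemann–Liouville integral: $I_{0+}^\alpha f(t)=\frac1{\Gamma(\alpha)}\int_0^t(t-\tau)^{\alpha-1}f(\tau)\,d\tau$ for $\alpha>0$, and $I^0_{0+}f=f$. Riemann–Liouville derivative: for $n-1<\alpha\le n$, $D_{0+}^\alpha f(t)=\frac{d^n}{dt^n}I_{0+}^{n-\alpha}f(t)$ for $t>0$ (with $D^0_{0+}f=f$). Caputo derivative: for $n-1<\alpha\le n$, ${}^cD_{0+}^\alpha f(t)=D_{0+}^\alpha\big[f(t)-\sum_{k=0}^{n-1}\frac{f^{(k)}(0)}{k!}t^k\big]$; in particular ${}^cD^0_{0+}f=f$. $C^{\alpha_0,n_0-1}[0,T]$ is the space of functions $y\in C^{n_0-1}[0,T]$ with ${}^cD_{0+}^{\alpha_0}y\in C[0,T]$ (i.e. extending continuously to $[0,T]$). $\Phi_{\beta}(t)=t^{\beta-1}/\Gamma(\beta)$ for $\beta>0$; thus $\Phi_{j+1}(t)=t^j/j!$, and $\Phi_{j+1-\alpha_i}=D_{0+}^{\alpha_i}\Phi_{j+1}$ when $\alpha_i\le j$. The bracket $\big[\sum_i a_i(t)I_{0+}^{\alpha_0-\alpha_i}\big]^k$ is the $k$-th power (composition) of the operator $g\mapsto\sum_{i=1}^m a_i\cdot I_{0+}^{\alpha_0-\alpha_i}g$, the $0$-th power being the identity. The infinite series is the limit of its partial sums, for each $t\in[0,T]$. A range of indices $j$ whose lower bound exceeds its upper bound is empty. A canonical fundamental system of solutions of (E) is a system of functions $y_0,\dots,y_{n_0-1}$,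 each satisfying (E), with $D^ky_j(t)|_{t=+0}=1$ if $k=j$ and $=0$ if $k\ne j$, for $k,j=0,1,\dots,n_0-1$, where $D^k=d^k/dt^k$. *)

(* Defs.v *)
(* Functions on [0, T] are represented by total functions R -> R;
   every notion below evaluated on [0, T] depends only on the values there. *)
From HB Require Import structures.
From mathcomp Require Export all_boot all_order all_algebra.
From mathcomp Require Export all_classical all_reals all_analysis.
Set Implicit Arguments.
Unset Strict Implicit.
Unset Printing Implicit Defensive.
Export Order.TTheory GRing.Theory Num.Theory.
Export numFieldNormedType.Exports.
Local Open Scope classical_set_scope.
Local Open Scope ring_scope.

(* Euler's Gamma function; meaningful for a > 0. *)
Definition Gamma (R : realType) (a : R) : R :=
  \int[lebesgue_measure]_(t in `]0, +oo[) (t `^ (a - 1) * expR (- t)).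

Definition Phi (R : realType) (b t : R) : R := t `^ (b - 1) / Gamma b.

(* Riemann-Liouville integral of order alpha >= 0. When alpha < 1 the kernel is
   singular at s = t; powR gives it the value 0 there, on a null set. *)
Definition RLint (R : realType) (alpha : R) (f : R -> R) (t : R) : R :=
  if alpha == 0 then f t
  else (Gamma alpha)^-1 *
       \int[lebesgue_measure]_(s in `[0, t]) ((t - s) `^ (alpha - 1) * f s).

(* The integer n with n - 1 < alpha <= n, for alpha >= 0. *)
Definition dorder (R : realType) (alpha : R) : nat := `|Num.ceil alpha|%N.

(* The library's total derivative derive1n returns a junk value at points of
   non-differentiability, hence the separate existence predicate. *)
Definition RLderivable (R : realType) (T alpha : R) (f : R -> R) : Prop :=
  forall (k : nat) (t : R), (k < dorder alpha)%N -> 0 < t < T ->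
    derivable (derive1n k (RLint ((dorder alpha)%:R - alpha) f)) t 1.

Definition RLderiv (R : realType) (alpha : R) (f : R -> R) (t : R) : R :=
  derive1n (dorder alpha) (RLint ((dorder alpha)%:R - alpha) f) t.

Definition dquot (R : realType) (f : R -> R) (t s : R) : R :=
  (f s - f t) / (s - t).

(* Derivative relative to [0, T], hence one-sided at 0 and T; f^(k)(0) below is
   derive_segn T k f 0. *)
Definition derive_seg (R : realType) (T : R) (f : R -> R) (t : R) : R :=
  lim (dquot f t s @[s --> within `[0, T] t^']).

Definition derive_segn (R : realType) (T : R) (k : nat) (f : R -> R) : R -> R :=
  iter k (derive_seg T) f.

(* C^k[0, T]. *)
Definition Ck (R : realType) (T : R) (k : nat) (f : R -> R) : Prop :=
  (forall (i : nat) (t : R), (i < k)%N -> 0 <= t <= T ->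
     cvg (dquot (derive_segn T i f) t s @[s --> within `[0, T] t^'])) /\
  (forall i : nat, (i <= k)%N ->
     {within `[0, T], continuous (derive_segn T i f)}).

Definition taylor_rem (R : realType) (T : R) (n : nat) (f : R -> R) (t : R) : R :=
  f t - \sum_(0 <= k < n) derive_segn T k f 0 / k`!%:R * t ^+ k.

Definition Caputo_derivable (R : realType) (T alpha : R) (f : R -> R) : Prop :=
  RLderivable T alpha (taylor_rem T (dorder alpha) f).

Definition Caputo (R : realType) (T alpha : R) (f : R -> R) (t : R) : R :=
  RLderiv alpha (taylor_rem T (dorder alpha) f) t.

(* C^{alpha, k}[0, T]; g is the continuous extension to [0, T] of the Caputo
   derivative, which is taken on the open interval only. *)
Definition Calphak (R : realType) (T alpha : R) (k : nat) (y : R -> R) : Prop :=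
  [/\ Ck T k y,
      Caputo_derivable T alpha y
    & exists g : R -> R, {within `[0, T], continuous g} /\
        forall t, 0 < t < T -> Caputo T alpha y t = g t].

(* In what follows only the indices 0, ..., m of alpha and 1, ..., m of a
   matter. *)

Definition is_solution (R : realType) (T : R) (m : nat) (alpha : nat -> R)
    (a : nat -> R -> R) (y : R -> R) : Prop :=
  (forall i, (i <= m)%N -> Caputo_derivable T (alpha i) y) /\
  (forall t, 0 < t < T ->
     Caputo T (alpha 0%N) y t =
       - \sum_(1 <= i < m.+1) a i t * Caputo T (alpha i) y t).

Definition canonical_system (R : realType) (T : R) (m : nat) (alpha : nat -> R)
    (a : nat -> R -> R) (n0 : nat) (y : 'I_n0 -> R -> R) : Prop :=
  (forall j, is_solution T m alpha a (y j)) /\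
  (forall k j : 'I_n0, derive1n k (y j) t @[t --> 0^'+] --> ((k == j)%:R : R)).

Definition Hset (R : realType) (m : nat) (alpha : nat -> R) (j : nat) : seq nat :=
  [seq i <- index_iota 1 m.+1 | 0 <= alpha i <= j%:R].

(* min H_j; the neutral value m is harmless since H_j is a subset of 1..m. *)
Definition hmin (R : realType) (m : nat) (alpha : nat -> R) (j : nat) : nat :=
  \big[minn/m]_(i <- Hset m alpha j) i.

Definition Vop (R : realType) (m : nat) (alpha : nat -> R) (a : nat -> R -> R)
    (g : R -> R) (t : R) : R :=
  \sum_(1 <= i < m.+1) a i t * RLint (alpha 0%N - alpha i) g t.

(* k-th term of the series for y_j, the innermost sum starting at i = h. *)
Definition sol_term (R : realType) (m : nat) (alpha : nat -> R)
    (a : nat -> R -> R) (h j k : nat) (t : R) : R :=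
  (-1) ^+ k.+1 *
  RLint (alpha 0%N)
    (iter k (Vop m alpha a)
       (fun s => \sum_(h <= i < m.+1) a i s * Phi (j.+1%:R - alpha i) s)) t.

(* y t = Phi_{j+1}(t) + the sum of that series, which is required to converge. *)
Definition given_by (R : realType) (m : nat) (alpha : nat -> R)
    (a : nat -> R -> R) (h j : nat) (y : R -> R) (t : R) : Prop :=
  (Phi j.+1%:R t + \sum_(0 <= k < N) sol_term m alpha a h j k t)
    @[N --> \oo] --> y t.

(* Main.v *)
(* The proof turns (E) into a Volterra equation for the fractional derivative.
   On [0, T], the functions y of C^{al, N}[0, T], N < al <= N + 1, with initial
   data y^(k)(0) = [k = j] are exactly y = Phi_{j+1} + I^al g with g continuous,
   and then g is the Caputo derivative of y of order al; by the semigroup law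
   I^a I^b = I^{a+b}, the Caputo derivative of order b <= N of y is
   [b <= j] Phi_{j+1-b} + I^{al-b} g.  Hence (E) reads g = - w - V g with
   V g = sum_i a_i I^{al-alpha_i} g, where w = sum_{alpha_i <= j} a_i
   Phi_{j+1-alpha_i}.  For p large V is a contraction for the weighted norm
   sup e^{-pt} |g t|, because I^b e^{pt} <= p^{-b} e^{pt}; the Neumann series of
   the unique solution g gives the announced formula.

   The semigroup law rests on Euler's relation between Beta and Gamma, obtained
   from associativity of the convolution of nonnegative functions. *)
Require Import Defs.
From mathcomp Require Import measurable_realfun lra ring.
Set Implicit Arguments.
Unset Strict Implicit.
Unset Printing Implicit Defensive.
Local Open Scope classical_set_scope.
Local Open Scope ring_scope.

(** The data live on [0, T], but the integral calculus is done for functions continuous on the whole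
    line. Composing with the retraction [clamp] passes from one to the other, harmlessly because the
    integrals only look back from [t] to 0. Associativity of convolution comes from Tonelli, hence
    for nonnegative functions; signed ones are reached by shifting and splitting. Several
    derivatives coexist: one-sided ones on [0, T] in [Ck] and in the Taylor polynomial, two-sided
    ones inside ]0, T[ in the initial limits and in the Riemann-Liouville derivative. [tower] links
    them by storing integral relations. Uniqueness is the delicate side: the last derivative of a
    competitor exists only pointwise in ]0, T[. With N = n_0 - 1, the gap n_0 > n_1 makes every n_i
    with i >= 1 at most N, so lower Caputo derivatives come from classical ones. H_0 nonempty forces
    alpha_m = 0; each H_j is then the final segment h_j, ..., m, and both displayed formulas have
    the same forcing term w. *)

Lemma ge0_integral_affine (R : realType) (c d : R) (f : R -> \bar R) :
  c != 0 -> measurable_fun setT f -> (forall x, (0 <= f x)%E) ->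
  (\int[lebesgue_measure]_x f x =
   `|c|%:E * \int[lebesgue_measure]_x f (c * x + d)%R)%E.
Proof.
move=> c0 mf f0.
pose phi (x : measurableTypeR R) : measurableTypeR R := c * x + d.
have mphi : measurable_fun [set: measurableTypeR R] phi.
  by apply: measurable_funD => //; apply: measurable_funM.
pose P : {measure set (measurableTypeR R) -> \bar R} :=
  measure_function_pushforward__canonical__measure_function_Measure
    lebesgue_measure mphi.
pose r := NngNum (normr_ge0 c).
pose mu : {measure set (measurableTypeR R) -> \bar R} := mscale r P.
(* Lebesgue measure is determined by its values on half-open intervals. A negative [c] reverses the
   preimage and moves its closed end, which leaves the length unchanged. *)
have mscE : forall A, measurable A -> (lebesgue_measure A = mu A)%E.
  apply: lebesgue_measure_unique => _ [[a b] /= _ <-].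
  rewrite lebesgue_measure_itv/= lte_fin /mu /mscale /= /pushforward.
  have [cp|cn] : 0 < c \/ c < 0 by apply/orP; rewrite orbC -neq_lt.
    have -> : phi @^-1` `]a, b]%classic = `](a - d) / c, (b - d) / c]%classic.
      apply/seteqP; split => x /=; rewrite !in_itv/= /phi;
        by rewrite ltr_pdivrMr// ler_pdivlMr// ltrBlDr lerBrDr (mulrC x).
    rewrite lebesgue_measure_itv/= lte_fin ltr_pM2r ?invr_gt0// ltrD2r.
    case: ifPn => // _; last by rewrite mule0.
    rewrite -!EFinD -EFinM gtr0_norm//; congr EFin.
    by rewrite -mulrBl mulrC divfK//; ring.
  have -> : phi @^-1` `]a, b]%classic = `[(b - d) / c, (a - d) / c[%classic.
    apply/seteqP; split => x /=; rewrite !in_itv/= /phi;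
      by rewrite ltr_ndivlMr// ler_ndivrMr// ltrBlDr lerBrDr (mulrC x) andbC.
  rewrite lebesgue_measure_itv/= lte_fin ltr_nM2r ?invr_lt0// ltrD2r.
  case: ifPn => // _; last by rewrite mule0.
  rewrite -!EFinD -EFinM ltr0_norm//; congr EFin.
  by field.
rewrite (eq_measure_integral mu); last by move=> A mA _; exact: mscE.
rewrite /mu ge0_integral_mscale//=.
by rewrite ge0_integral_pushforward.
Qed.

(** Extended values over the whole line let Tonelli act on nonnegative functions with no
    integrability check; finiteness is settled afterwards. Factors vanishing on the left of 0 reduce
    the integral to one over [0, t]. *)
Definition convol (R : realType) (f g : R -> \bar R) (t : R) : \bar R :=
  (\int[lebesgue_measure]_s (f (t - s)%R * g s))%E.

Section convol.
Local Open Scope ereal_scope.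
Variable R : realType.
Implicit Types f g h : R -> \bar R.

Lemma measurable_convol_integrand f g : measurable_fun setT f ->
  measurable_fun setT g ->
  measurable_fun setT (fun z : measurableTypeR R * measurableTypeR R =>
    f (z.1 - z.2)%R * g z.2).
Proof.
move=> mf mg; apply: emeasurable_funM.
  apply: (measurableT_comp mf).
  by apply: measurable_funB; [exact: measurable_fst|exact: measurable_snd].
by apply: (measurableT_comp mg); exact: measurable_snd.
Qed.

Lemma convol_ge0 f g t : (forall x, 0 <= f x) -> (forall x, 0 <= g x) ->
  0 <= convol f g t.
Proof. by move=> f0 g0; apply: integral_ge0 => s _; rewrite mule_ge0. Qed.

Lemma convolC f g : measurable_fun setT f -> measurable_fun setT g ->
  (forall x, 0 <= f x) -> (forall x, 0 <= g x) -> convol f g = convol g f.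
Proof.
move=> mf mg f0 g0; apply/funext => t; rewrite /convol.
rewrite (@ge0_integral_affine R (-1) t) ?oppr_eq0 ?oner_eq0//; first last.
- by move=> x; rewrite mule_ge0.
- apply: emeasurable_funM => //; apply: (measurableT_comp mf).
  exact: measurable_funB.
rewrite normrN1 mul1e; apply: eq_integral => s _.
have -> : (t - (-1 * s + t) = s)%R by ring.
by rewrite mulN1r addrC muleC.
Qed.

(** Tonelli, then the translation of [u] by [s] in the inner integral. *)
Lemma convolA f g h :
  measurable_fun setT f -> measurable_fun setT g -> measurable_fun setT h ->
  (forall x, 0 <= f x) -> (forall x, 0 <= g x) -> (forall x, 0 <= h x) ->
  convol f (convol g h) = convol (convol f g) h.
Proof.
move=> mf mg mh f0 g0 h0; apply/funext => t; rewrite /convol.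
transitivity (\int[lebesgue_measure]_u \int[lebesgue_measure]_s
   (f (t - u)%R * (g (u - s)%R * h s))).
  apply: eq_integral => u _; rewrite ge0_integralZl//.
  - apply: emeasurable_funM => //; apply: (measurableT_comp mg).
    exact: measurable_funB.
  - by move=> s _; rewrite mule_ge0.
rewrite (@fubini_tonelli _ _ _ _ _ (@lebesgue_measure R) (@lebesgue_measure R)
   (fun z => f (t - z.1)%R * (g (z.1 - z.2)%R * h z.2)))/=; first last.
- by move=> x; rewrite !mule_ge0.
- apply: emeasurable_funM; last exact: measurable_convol_integrand.
  apply: (measurableT_comp mf).
  by apply: measurable_funB => //; exact: measurable_fst.
apply: eq_integral => s _.
rewrite (@ge0_integral_affine R 1 s) ?oner_eq0//; first last.
- by move=> x; rewrite !mule_ge0.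
- apply: emeasurable_funM; first by apply: (measurableT_comp mf);
  exact: measurable_funB.
  by apply: emeasurable_funM => //; apply: (measurableT_comp mg);
    exact: measurable_funB.
rewrite normr1 mul1e.
rewrite -ge0_integralZr//; last 2 first.
- apply: emeasurable_funM; last by [].
  by apply: (measurableT_comp mf); exact: measurable_funB.
- by move=> u _; rewrite mule_ge0.
apply: eq_integral => u _; rewrite mul1r addrK muleA.
by have -> : (t - (u + s) = t - s - u)%R by ring.
Qed.

End convol.

(** * The kernels t^(a-1) and the Gamma function *)

(** Vanishing on the closed left half-line makes convolution with the kernel causal. At 0 it differs
    from [powR] when [a = 1], where [powR] gives 1; one point is null for the integrals. *)
Definition kpow (R : realType) (a u : R) : R := if 0 < u then u `^ (a - 1)
  else 0.

Section kpow.
Variable R : realType.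
Implicit Types a b p s t u : R.

Lemma continuous_powR_pos a t : 0 < t -> {for t, continuous (fun x : R =>
  x `^ a)}.
Proof.
move=> t0; apply: differentiable_continuous; apply/derivable1_diffP.
by apply: derivable_powR; rewrite in_itv/= t0.
Qed.

Lemma kpow_ge0 a u : 0 <= kpow a u.
Proof. by rewrite /kpow; case: ifP => // _; exact: powR_ge0. Qed.

Lemma measurable_kpow a : measurable_fun setT (kpow a).
Proof.
apply: measurable_fun_ifT; last by [].
- exact: measurable_fun_ltr.
- exact: (@measurable_powR R (a - 1)).
Qed.

Lemma kpowZ a t u : 0 < t -> kpow a (t * u) = t `^ (a - 1) * kpow a u.
Proof.
move=> t0; rewrite /kpow pmulr_rgt0//; case: ifP => [u0|];
  last by rewrite mulr0.
by rewrite powRM// ltW.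
Qed.

(** The integrand may blow up at 0, so the fundamental theorem is applied on [1/(n+1), 1] with
    primitive s^a / a, and the bound passes to the increasing union. *)
Lemma integral_powR01_le a : 0 < a ->
  (\int[lebesgue_measure]_(s in `]0%R, 1%R]) (s `^ (a - 1))%:E <= (a^-1)%:E)%E.
Proof.
move=> a0; pose F (n : nat) : set R := `[n.+1%:R^-1, 1]%classic.
have bnd (n : nat) : (\int[lebesgue_measure]_(s in F n)
  (s `^ (a - 1))%:E <= (a^-1)%:E)%E.
  rewrite /F; have [n0|n0] := leqP n 0.
    move: n0; rewrite leqn0 => /eqP ->.
    by rewrite invr1 set_itv1 integral_set1 lee_fin invr_ge0 ltW.
  have n1 : (n.+1%:R^-1 : R) < 1 by rewrite invf_lt1 ?ltr1n// ltr0n.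
  have ngt0 : 0 < (n.+1%:R^-1 : R) by rewrite invr_gt0.
  have dF (x : R) : 0 < x -> is_derive x 1 (fun x : R =>
    a^-1 * x `^ a) (x `^ (a - 1)).
    move=> x0; apply: is_derive_eq; first by apply: is_deriveZ;
      exact: is_derive1_powR.
    by rewrite /GRing.scale/= mulrA mulVf ?mul1r// gt_eqF.
  have cF (x : R) : 0 < x -> {for x, continuous (fun x : R => a^-1 * x `^ a)}.
    by move=> x0; apply: differentiable_continuous; apply/derivable1_diffP;
      apply: ex_derive; exact: dF.
  rewrite (@continuous_FTC2 _ _ (fun x : R => a^-1 * x `^ a))//.
  - rewrite powR1 mulr1 -EFinB lee_fin lerBlDr lerDl.
    by rewrite mulr_ge0 ?powR_ge0// invr_ge0 ltW.
  - apply: continuous_in_subspaceT => x; rewrite inE/= in_itv/= => /andP[nx _].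
    by apply: continuous_powR_pos; exact: lt_le_trans nx.
  - split.
    + move=> x; rewrite in_itv/= => /andP[nx _]; apply: ex_derive.
      by apply: dF; exact: lt_trans nx.
    + by apply: cvg_at_right_filter; exact: cF.
    + by apply: cvg_at_left_filter; exact: cF.
  - move=> x; rewrite in_itv/= => /andP[nx _]; rewrite derive1E.
    by apply: derive_val; apply: dF; exact: lt_trans nx.
have UF : `]0%R, 1%R]%classic = \bigcup_n F n.
  apply/seteqP; split => [x|x [n _]]/=; rewrite /F /= !in_itv/= => /andP[x0 x1].
    exists (Num.trunc x^-1) => //=; rewrite in_itv/= x1 andbT.
    by rewrite invf_ple ?posrE ?ltr0n// ltW// truncnS_gt.
  by rewrite x1 andbT (lt_le_trans _ x0)// invr_gt0.
rewrite UF; apply: cvge_le (ge0_nondecreasing_set_cvg_integral _ _ _ _).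
- by apply: nearW => n; exact: bnd.
- move=> n m nm; apply/subsetPset => x; rewrite /F/= !in_itv/= => /andP[nx ->].
  by rewrite andbT (le_trans _ nx)// lef_pV2 ?posrE// ler_nat ltnS.
- by move=> n; exact: measurable_itv.
- move=> n; apply: measurable_funTS; apply/measurable_EFinP.
  exact: (@measurable_powR R (a - 1)).
- by move=> n x _; rewrite lee_fin powR_ge0.
Qed.

Lemma powR_le_expR a : exists C : R, 0 < C /\ forall s, 1 <= s ->
  s `^ (a - 1) <= C * expR (s / 2).
Proof.
(* The inequality ln x <= x - 1 at x = s / (2b) yields b ln s <= b ln (2b) + s / 2, whence C =
   (2b)^b. The rate 1/2 leaves a decay e^(-s/2) in the Gamma integrand. *)
pose b := `|a - 1| + 1; have b0 : 0 < b by rewrite ltr_wpDl.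
exists (expR (b * ln (2 * b))); split => [|s s1]; first exact: expR_gt0.
have s0 : 0 < s by exact: lt_le_trans s1.
rewrite -expRD /powR gt_eqF// ler_expR.
have ls : ln s <= ln (2 * b) + s / (2 * b).
  have sb0 : 0 < s / (2 * b) by rewrite divr_gt0 ?mulr_gt0.
  have /le_ln1Dx : -1 < s / (2 * b) - 1 by lra.
  rewrite addrCA subrr addr0 ln_div ?posrE ?mulr_gt0//; lra.
have ls0 : 0 <= ln s by exact: ln_ge0.
apply: (@le_trans _ _ (b * ln s)).
  by rewrite ler_wpM2r// (le_trans (ler_norm _))// /b lerDl.
apply: (le_trans (ler_wpM2l (ltW b0) ls)).
rewrite mulrDr lerD2l le_eqVlt; apply/orP; left; apply/eqP.
by field; rewrite gt_eqF.
Qed.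

End kpow.

Definition ekpow (R : realType) (a u : R) : \bar R := (kpow a u)%:E.
Definition eexp (R : realType) (p u : R) : \bar R := (expR (p * u))%:E.

Section Gamma.
Variable R : realType.
Implicit Types a b p s t u : R.
Let mu := @lebesgue_measure R.

Lemma measurable_ekpow a : measurable_fun setT (ekpow a).
Proof. by apply/measurable_EFinP; exact: measurable_kpow. Qed.

Lemma ekpow_ge0 a u : (0 <= ekpow a u)%E.
Proof. by rewrite lee_fin kpow_ge0. Qed.

Lemma measurable_expRM p : measurable_fun setT (fun u => expR (p * u)).
Proof. by apply: measurableT_comp => //; exact: measurable_funM. Qed.

Lemma measurable_eexp p : measurable_fun setT (eexp p).
Proof. by apply/measurable_EFinP; exact: measurable_expRM. Qed.

Lemma eexp_ge0 p u : (0 <= eexp p u)%E.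
Proof. by rewrite lee_fin expR_ge0. Qed.

Lemma measurable_Gamma_integrand a :
  measurable_fun setT (fun s => (kpow a s * expR (- s))%:E).
Proof.
apply/measurable_EFinP; apply: measurable_funM; first exact: measurable_kpow.
by apply: measurableT_comp.
Qed.

Lemma Gamma_integrand_ge0 a s : (0 <= (kpow a s * expR (- s))%:E)%E.
Proof. by rewrite lee_fin mulr_ge0 ?kpow_ge0 ?expR_ge0. Qed.

Lemma GammaE a : Gamma a = fine (\int[mu]_s (kpow a s * expR (- s))%:E)%E.
Proof.
rewrite /Gamma/= /Rintegral; congr fine; rewrite integral_mkcond.
apply: eq_integral => s _; rewrite patchE /kpow; case: ifPn => [|].
  by rewrite inE/= in_itv/= andbT => ->.
by rewrite notin_setE/= in_itv/= andbT => /negP/negbTE ->; rewrite mul0r.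
Qed.

Lemma integral_Gamma_lty a : 0 < a ->
  (\int[mu]_s (kpow a s * expR (- s))%:E < +oo)%E.
Proof.
move=> a0; have [C [C0 hC]] := powR_le_expR a.
pose f1 := (fun s => (s `^ (a - 1))%:E) \_ (`]0, 1] : set R).
(* The density of rate 1/2 carries the factor 1/2, so [f2] is C e^(-s/2) on s >= 0, with a known
   finite integral. *)
pose f2 s := ((2 * C)%:E * (exponential_pdf 2^-1 s)%:E)%E.
have mf1 : measurable_fun setT f1.
  apply/(measurable_restrictT _ _).1; first exact: measurable_itv.
  apply: measurable_funTS; apply/measurable_EFinP.
  exact: (@measurable_powR R (a - 1)).
have f10 s : (0 <= f1 s)%E by apply: erestrict_ge0 => x _;
  rewrite lee_fin powR_ge0.
have me : measurable_fun setT (fun s => (@exponential_pdf R 2^-1 s)%:E).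
  by apply/measurable_EFinP; exact: measurable_exponential_pdf.
have e0 (s : R) : (0 <= (@exponential_pdf R 2^-1 s)%:E)%E.
  by rewrite lee_fin exponential_pdf_ge0.
have mf2 : measurable_fun setT f2 by apply: emeasurable_funM.
have f20 s : (0 <= f2 s)%E by rewrite mule_ge0// lee_fin mulr_ge0// ltW.
apply: (@le_lt_trans _ _ (\int[mu]_s (f1 s + f2 s)))%E.
  apply: ge0_le_integral => //.
  - by move=> s _; exact: Gamma_integrand_ge0.
  - exact: measurable_Gamma_integrand.
  - by apply: emeasurable_funD.
  - move=> s _; rewrite /kpow; case: ifPn => [s0|_];
    last by rewrite mul0r adde_ge0.
    have [s1|s1] := leP s 1.
      apply: (@le_trans _ _ (f1 s)); last by rewrite leeDl.
      rewrite /f1 patchE mem_set/= ?in_itv/= ?s0// lee_fin.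
      by rewrite ler_piMr ?powR_ge0// -expR0 ler_expR oppr_le0 ltW.
    apply: (@le_trans _ _ (f2 s)); last by rewrite leeDr.
    rewrite /f2 /exponential_pdf patchE mem_set/= ?in_itv/= ?(ltW s0)//.
    rewrite -EFinM lee_fin.
    apply: (le_trans (ler_wpM2r (expR_ge0 _) (hC _ (ltW s1)))).
    rewrite -mulrA -expRD le_eqVlt; apply/orP; left; apply/eqP.
    have -> : s / 2 - s = - 2^-1 * s by field.
    by field.
rewrite ge0_integralD//; apply: lte_add_pinfty.
  rewrite -integral_mkcond; apply: le_lt_trans (integral_powR01_le a0) _.
  exact: ltry.
by rewrite ge0_integralZl// ?lee_fin ?mulr_ge0// ?ltW//
  integral_exponential_pdf ?mule1 ?ltry.
Qed.

Lemma integral_Gamma a : 0 < a ->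
  (\int[mu]_s (kpow a s * expR (- s))%:E = (Gamma a)%:E)%E.
Proof.
move=> a0; rewrite GammaE fineK// ge0_fin_numE ?integral_Gamma_lty//.
by apply: integral_ge0 => s _; exact: Gamma_integrand_ge0.
Qed.

Lemma Gamma_gt0 a : 0 < a -> 0 < Gamma a.
Proof.
move=> a0; rewrite -lte_fin -integral_Gamma//.
(* On [1, 2] one has 0 <= ln s <= 1, so s^(a-1) >= e^(-|a-1|), while e^(-s) >= e^(-2). *)
pose c := expR (- `|a - 1| - 2).
apply: (@lt_le_trans _ _ (\int[mu]_(s in `[1%R, 2%R]) c%:E)%E).
  rewrite integral_cst//.
  rewrite [X in (_ * X)%E]lebesgue_measure_itv/=
    lte_fin ltr1n -EFinB -EFinM lte_fin.
  by rewrite mulr_gt0 ?expR_gt0//; lra.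
apply: (@le_trans _ _ (\int[mu]_(s in `[1%R, 2%R])
  (kpow a s * expR (- s))%:E)%E).
  apply: ge0_le_integral => //.
  - by move=> s _; rewrite lee_fin expR_ge0.
  - by apply: measurable_funTS; exact: measurable_Gamma_integrand.
  move=> s; rewrite /= in_itv/= => /andP[s1 s2]; rewrite lee_fin /kpow.
  have s0 : 0 < s by exact: lt_le_trans s1.
  rewrite s0 /powR gt_eqF// -expRD ler_expR lerD ?lerN2//.
  rewrite lerNl; apply: le_trans (ler_norm _) _; rewrite normrN normrM.
  rewrite ler_piMr// ger0_norm ?ln_ge0//.
  have /le_ln1Dx : -1 < s - 1 by lra.
  by rewrite addrCA subrr addr0; lra.
apply: ge0_subset_integral => //.
- exact: measurable_Gamma_integrand.
- by move=> s _; exact: Gamma_integrand_ge0.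
Qed.

Lemma Gamma1 : Gamma 1 = 1 :> R.
Proof.
rewrite /Gamma /Rintegral -[RHS]/(fine 1%:E) -(@integral_exponential_pdf R 1)//.
congr fine; rewrite integral_itv_obnd_cbnd; last first.
  apply/measurable_EFinP; apply: measurable_funTS; apply: measurable_funM.
    exact: (@measurable_powR R (1 - 1)).
  exact: measurableT_comp.
rewrite integral_mkcond; apply: eq_integral => s _.
rewrite patchE /exponential_pdf patchE; case: ifP => // _.
by rewrite subrr powRr0 mulN1r.
Qed.

End Gamma.

(* [Gamma], [RLint] and [Phi] are made opaque so that failing conversion tests
   do not unfold the integrals. *)
Local Opaque Gamma.

(** * Laplace transform of the kernels and Euler's Beta relation *)

Section Beta.
Variable R : realType.
Implicit Types a b p s t u : R.
Let mu := @lebesgue_measure R.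

Lemma integral_kpow_expR a p : 0 < a -> 0 < p ->
  (\int[mu]_s (kpow a s * expR (- (p * s)))%:E = (Gamma a * p `^ (- a))%:E)%E.
Proof.
move=> a0 p0.
have mf : measurable_fun setT (fun s => (kpow a s * expR (- (p * s)))%:E).
  apply/measurable_EFinP; apply: measurable_funM; first exact: measurable_kpow.
  by apply: measurableT_comp => //; apply: measurableT_comp => //;
    exact: measurable_funM.
have f0 s : (0 <= (kpow a s * expR (- (p * s)))%:E)%E.
  by rewrite lee_fin mulr_ge0 ?kpow_ge0 ?expR_ge0.
have := integral_Gamma a0; rewrite (@ge0_integral_affine R p 0) ?gt_eqF//;
  first last.
- by move=> s; exact: Gamma_integrand_ge0.
- exact: measurable_Gamma_integrand.
rewrite (_ : (\int[lebesgue_measure]_x _ =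
  (p `^ (a - 1))%:E * \int[mu]_s (kpow a s * expR (- (p * s)))%:E)%E);
  last first.
  rewrite -ge0_integralZl// ?lee_fin ?powR_ge0//.
  by apply: eq_integral => s _; rewrite addr0 kpowZ// -EFinM mulrA.
rewrite muleA -EFinM gtr0_norm//.
have -> : p * p `^ (a - 1) = p `^ a.
  rewrite -{1}[p]powRr1 ?(ltW p0)// -powRD ?(gt_eqF p0) ?implybT//.
  by congr (_ `^ _); ring.
move=> h; rewrite mulrC EFinM -h muleA -EFinM powRN mulVf ?mul1e//.
by rewrite gt_eqF ?powR_gt0.
Qed.

(** Since e^(p(t-s)) = e^(pt) e^(-ps), the exponential, deliberately not cut off at 0, is an exact
    eigenfunction. Its eigenvalue yields both Euler's relation and the factor p^(-b) of the weighted
    estimates. *)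
Lemma convol_eexp_ekpow a p t : 0 < a -> 0 < p ->
  convol (eexp p) (ekpow a) t = ((Gamma a * p `^ (- a))%:E * eexp p t)%E.
Proof.
move=> a0 p0; rewrite -integral_kpow_expR// -ge0_integralZr//; first last.
- by rewrite eexp_ge0.
- by move=> s _; rewrite lee_fin mulr_ge0 ?kpow_ge0 ?expR_ge0.
- apply/measurable_EFinP; apply: measurable_funM; first exact: measurable_kpow.
  by apply: measurableT_comp => //; apply: measurableT_comp => //;
    exact: measurable_funM.
apply: eq_integral => s _; rewrite /eexp /ekpow -!EFinM; congr EFin.
by rewrite mulrC -mulrA -expRD; congr (_ * expR _); ring.
Qed.

Lemma convolZr f g (c : \bar R) t : measurable_fun setT f ->
  measurable_fun setT g ->
  (forall x, 0 <= f x)%E -> (forall x, 0 <= g x)%E -> (0 <= c)%E ->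
  convol f (fun x => c * g x)%E t = (c * convol f g t)%E.
Proof.
move=> mf mg f0 g0 c0; rewrite /convol -ge0_integralZl//; first last.
- by move=> s _; rewrite mule_ge0.
- apply: emeasurable_funM => //; apply: (measurableT_comp mf).
  exact: measurable_funB.
by apply: eq_integral => s _; rewrite muleCA.
Qed.

Lemma convolZl f g (c : \bar R) t : measurable_fun setT f ->
  measurable_fun setT g ->
  (forall x, 0 <= f x)%E -> (forall x, 0 <= g x)%E -> (0 <= c)%E ->
  convol (fun x => c * f x)%E g t = (c * convol f g t)%E.
Proof.
move=> mf mg f0 g0 c0; rewrite convolC//; last 2 first.
- by apply: emeasurable_funM.
- by move=> x; rewrite mule_ge0.
by rewrite convolZr// (convolC mf).
Qed.

(** The substitution of t s for s gives the power t^(1 + (a-1) + (b-1)). The constant is the Beta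
    integral, possibly infinite at this stage; for t <= 0 both sides still vanish because 0 times
    +oo is 0 in [\bar R]. *)
Lemma convol_ekpow_homog a b t :
  convol (ekpow a) (ekpow b) t =
  (convol (ekpow a) (ekpow b) 1 * ekpow (a + b) t)%E.
Proof.
have [t0|t0] := ltP 0 t; last first.
  rewrite [RHS](_ : _ = 0%E); last by rewrite {3}/ekpow /kpow ltNge t0/= mule0.
  rewrite /convol (eq_integral (cst 0%E)) ?integral_cst ?mul0e// => s _.
  rewrite /ekpow /kpow; case: ifPn => [ts|]; last by rewrite mul0e.
  case: ifPn => s0; last by rewrite mule0.
  by have := addr_gt0 ts s0; rewrite subrK ltNge t0.
have mc (u : R) : measurable_fun setT (fun s => ekpow a (u - s) * ekpow b s)%E.
  apply: emeasurable_funM; last exact: measurable_ekpow.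
  by apply: measurableT_comp; [exact: measurable_ekpow|exact: measurable_funB].
rewrite {1}/convol (@ge0_integral_affine R t 0) ?gt_eqF//; last first.
  by move=> s; rewrite mule_ge0// ekpow_ge0.
rewrite (_ : (\int[lebesgue_measure]_x _ = (t `^ (a - 1)
  * t `^ (b - 1))%:E * convol (ekpow a) (ekpow b) 1)%E); last first.
  rewrite /convol -ge0_integralZl//; first last.
  - by rewrite lee_fin mulr_ge0 ?powR_ge0.
  - by move=> s _; rewrite mule_ge0 ?ekpow_ge0.
  - exact: mc.
  apply: eq_integral => s _; rewrite addr0.
  have -> : t - t * s = t * (1 - s) by ring.
  by rewrite /ekpow !kpowZ// -!EFinM; congr EFin; ring.
rewrite muleA -EFinM muleC; congr (_ * _%:E)%E.
rewrite gtr0_norm// /kpow t0 -{1}[t]powRr1 ?(ltW t0)//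
  -!powRD ?(gt_eqF t0) ?implybT//.
by congr (_ `^ _); ring.
Qed.

(* Euler's relation between Beta and Gamma: exponentials are eigenfunctions of
   convolution with [ekpow], so convolving once more with [eexp 1] determines
   the constant left open by homogeneity. *)
Lemma convol_ekpow a b t : 0 < a -> 0 < b ->
  convol (ekpow a) (ekpow b) t =
  ((Gamma a * Gamma b / Gamma (a + b))%:E * ekpow (a + b) t)%E.
Proof.
move=> a0 b0; have ab0 : 0 < a + b by exact: addr_gt0.
have [ga gb gab] := And3 (Gamma_gt0 a0) (Gamma_gt0 b0) (Gamma_gt0 ab0).
set C := (convol (ekpow a) (ekpow b) 1 : \bar R).
have C0 : (0 <= C)%E by apply: convol_ge0 => x; exact: ekpow_ge0.
rewrite convol_ekpow_homog -/C; congr (_ * _)%E.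
have E1 c u : 0 < c -> convol (eexp 1) (ekpow c)
  u = ((Gamma c)%:E * eexp 1 u)%E.
  by move=> c0; rewrite convol_eexp_ekpow// powR1 mulr1.
have me := @measurable_eexp R 1; have e0 := @eexp_ge0 R 1.
(* At the point 0, where [eexp 1] is 1, associativity becomes C Gamma(a+b) = Gamma(a) Gamma(b); this
   also excludes an infinite [C]. *)
have /(congr1 (@^~ 0)) := convolA me (measurable_ekpow a) (measurable_ekpow b)
  e0 (@ekpow_ge0 R a) (@ekpow_ge0 R b).
rewrite (_ : convol (ekpow a) (ekpow b) = (fun x => C * ekpow (a + b) x)%E);
  last first.
  by apply/funext => x; exact: convol_ekpow_homog.
rewrite convolZr//; first last.
- exact: ekpow_ge0.
- exact: measurable_ekpow.
rewrite (_ : convol (eexp 1) (ekpow a) = (fun x => (Gamma a)%:E * eexp 1 x)%E);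
  last by apply/funext => x; exact: E1.
have ga' : (0 <= (Gamma a)%:E)%E by rewrite lee_fin; exact: ltW ga.
rewrite (convolZl 0 me (measurable_ekpow b) e0 (@ekpow_ge0 R b) ga').
rewrite (E1 _ 0 b0) (E1 _ 0 ab0) /eexp mulr0 expR0 !mule1 -EFinM => h.
have Cfin : C \is a fin_num.
  move: h; case: C C0 => [r _ _ //|_|//].
  by rewrite gt0_mulye ?lte_fin.
move: h; rewrite -(fineK Cfin) -EFinM => -[h]; congr EFin.
by rewrite -h mulfK ?gt_eqF.
Qed.

End Beta.

(** * Riemann-Liouville integrals *)

(** Not the positive part: [f] is cut off to the positive half-line, which turns the integral over
    [0, t] into a convolution with [ekpow]. *)
Definition epos (R : realType) (f : R -> R) (u : R) : \bar R :=
  (if 0 < u then f u else 0)%:E.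

Section RLint.
Variable R : realType.
Implicit Types (a b p s t u M : R) (f g : R -> R).
Let mu := @lebesgue_measure R.

Lemma measurable_epos f : measurable_fun setT f -> measurable_fun setT (epos f).
Proof.
move=> mf; apply/measurable_EFinP; apply: measurable_fun_ifT => //.
exact: measurable_fun_ltr.
Qed.

Lemma epos_ge0 f u : (forall x, 0 <= f x) -> (0 <= epos f u)%E.
Proof. by move=> f0; rewrite /epos lee_fin; case: ifP. Qed.

Lemma RLint0 f : RLint 0 f = f.
Proof. by apply/funext => t; rewrite /RLint eqxx. Qed.

Lemma eq_RLint b f g t : 0 <= b -> 0 <= t -> (forall s, 0 <= s <= t ->
  f s = g s) ->
  RLint b f t = RLint b g t.
Proof.
move=> b0 t0 fg; rewrite /RLint; case: ifP => _; first by rewrite fg// lexx t0.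
congr (_ * _); apply: eq_Rintegral => s; rewrite inE/= in_itv/= => st.
by rewrite fg.
Qed.

Lemma RLint_neg b f t : 0 < b -> t <= 0 -> RLint b f t = 0.
Proof.
move=> b0; rewrite /RLint gt_eqF// le_eqVlt => /predU1P[->|t0].
  by rewrite set_itv1 Rintegral_set1 mulr0.
by rewrite set_itv_ge ?Rintegral_set0 ?mulr0// bnd_simp -ltNge.
Qed.

Lemma measurable_RLint_integrand b f t : measurable_fun setT f ->
  measurable_fun setT (fun s => (t - s) `^ (b - 1) * f s).
Proof.
move=> mf; apply: measurable_funM => //.
by apply: (measurableT_comp (@measurable_powR R (b - 1)));
  exact: measurable_funB.
Qed.

Lemma convol_epos b f t : measurable_fun setT f ->
  convol (ekpow b) (epos f) t =
  (\int[mu]_(s in `[0%R, t]) ((t - s) `^ (b - 1) * f s)%:E)%E.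
Proof.
move=> mf; apply/esym.
have mi := measurable_RLint_integrand b t mf.
rewrite -integral_itv_bndo_bndc; last by apply/measurable_EFinP;
  exact: measurable_funTS.
rewrite -integral_itv_obnd_cbnd; last by apply/measurable_EFinP;
  exact: measurable_funTS.
rewrite integral_mkcond; apply: eq_integral => s _;
  rewrite patchE /ekpow /epos /kpow subr_gt0.
case: ifPn; first by rewrite inE/= in_itv/= => /andP[-> ->].
rewrite notin_setE/= in_itv/= => /negP;
  rewrite negb_and => /orP[/negbTE->|/negbTE->].
  by rewrite mule0.
by rewrite mul0e.
Qed.

Lemma RLint_convol b f t : 0 < b -> measurable_fun setT f ->
  RLint b f t = (Gamma b)^-1 * fine (convol (ekpow b) (epos f) t).
Proof. by move=> b0 mf; rewrite /RLint gt_eqF// convol_epos. Qed.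

(** After [f] is replaced by its bound M e^(ps), enlarging the domain to the whole line brings in
    the exact eigenfunction. *)
Lemma integral_RLint_integrand_le b p M f t : 0 < b -> 0 < p -> 0 <= M ->
  measurable_fun setT f ->
  (forall s, 0 <= s <= t -> `|f s| <= M * expR (p * s)) ->
  (\int[mu]_(s in `[0%R, t]) `|((t - s) `^ (b - 1) * f s)%:E| <=
    (M * (Gamma b * p `^ (- b)) * expR (p * t))%:E)%E.
Proof.
move=> b0 p0 M0 mf fM.
have mi := measurable_RLint_integrand b t mf.
have me : measurable_fun setT (fun s => ekpow b (t - s) * eexp p s)%E.
  apply: emeasurable_funM; last exact: measurable_eexp.
  by apply: (measurableT_comp (@measurable_ekpow R b)); exact: measurable_funB.
have e0 s : (0 <= ekpow b (t - s) * eexp p s)%E.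
  by rewrite mule_ge0 ?ekpow_ge0 ?eexp_ge0.
(* The end point s = t is dropped because the kernels disagree there for b = 1: [powR] gives 1 and
   [kpow] gives 0. *)
rewrite -integral_itv_bndo_bndc; last first.
  by apply/measurable_EFinP; apply: measurable_funTS; exact: measurableT_comp.
apply: (@le_trans _ _ (M%:E * convol (ekpow b) (eexp p) t)%E); last first.
  rewrite (convolC (@measurable_ekpow R b) (@measurable_eexp R p)); first last.
  - exact: eexp_ge0.
  - exact: ekpow_ge0.
  by rewrite convol_eexp_ekpow// /eexp -!EFinM mulrA.
rewrite /convol -ge0_integralZl//.
apply: (@le_trans _ _ (\int[mu]_(s in `[0%R, t[) (M%:E * (ekpow b (t - s)
  * eexp p s)))%E).
  apply: ge0_le_integral => //.
  - by apply/measurable_EFinP; apply: measurable_funTS; exact: measurableT_comp.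
  - by apply: measurable_funTS; apply: emeasurable_funM.
  move=> s; rewrite /= in_itv/= => /andP[s0 st].
  rewrite /ekpow /eexp /kpow subr_gt0 st -!EFinM lee_fin normrM.
  rewrite ger0_norm ?powR_ge0// mulrCA ler_wpM2l ?powR_ge0// fM// s0 ltW//.
apply: ge0_subset_integral => //.
- by apply: emeasurable_funM.
- by move=> s _; rewrite mule_ge0.
Qed.

Lemma continuous_bounded_segment f t : continuous f ->
  exists2 M, 0 <= M & forall s, 0 <= s <= t -> `|f s| <= M.
Proof.
move=> cf; have [t0|t0] := leP 0 t; last first.
  by exists 0 => // s /andP[s0 /(le_trans s0)]; rewrite leNgt t0.
have cn : {within `[0, t], continuous (fun s => `|f s|)}.
  apply: continuous_subspaceT => x.
  by apply: continuous_comp; [exact: cf|exact: norm_continuous].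
have [c _ fc] := EVT_max t0 cn.
by exists `|f c| => // s st; apply: fc; rewrite in_itv.
Qed.

Lemma RLint_integrable b f t : 0 < b -> continuous f ->
  mu.-integrable `[0, t] (EFin \o (fun s => (t - s) `^ (b - 1) * f s)).
Proof.
move=> b0 cf; have mf := continuous_measurable_fun cf.
have [M M0 fM] := continuous_bounded_segment t cf.
apply/integrableP; split.
  by apply/measurable_EFinP; apply: measurable_funTS;
    exact: measurable_RLint_integrand.
apply: le_lt_trans (@integral_RLint_integrand_le b 1 M f t _ _ _ _ _) _ => //.
  move=> s st; apply: (le_trans (fM _ st)); rewrite ler_peMr//.
  by rewrite -[leLHS]expR0 ler_expR mul1r; case/andP: st.
exact: ltry.
Qed.

Lemma RLint_bound b p M f t : 0 < b -> 0 < p -> 0 <= M -> continuous f ->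
  (forall s, 0 <= s <= t -> `|f s| <= M * expR (p * s)) ->
  `|RLint b f t| <= M * p `^ (- b) * expR (p * t).
Proof.
move=> b0 p0 M0 cf fM; rewrite /RLint gt_eqF// normrM.
have g0 := Gamma_gt0 b0.
rewrite gtr0_norm ?invr_gt0// mulrC ler_pdivrMr//.
apply: (le_trans (le_normr_Rintegral _ (RLint_integrable t b0 cf))) => //.
rewrite /Rintegral -lee_fin fineK.
  apply: (le_trans (integral_RLint_integrand_le b0 p0 M0
    (continuous_measurable_fun cf) fM)).
  by rewrite lee_fin le_eqVlt; apply/orP; left; apply/eqP; ring.
rewrite ge0_fin_numE ?integral_ge0//.
by have /integrableP[] := RLint_integrable t b0 cf.
Qed.

Lemma RLintD b f g t : 0 <= b -> continuous f -> continuous g ->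
  RLint b (fun s => f s + g s) t = RLint b f t + RLint b g t.
Proof.
rewrite le_eqVlt => /predU1P[<-|b0] cf cg; first by rewrite !RLint0.
rewrite /RLint gt_eqF// -mulrDr -RintegralD//; try exact: RLint_integrable.
by congr (_ * _); apply: eq_Rintegral => s _; rewrite mulrDr.
Qed.

Lemma RLintZ b (c : R) f t : 0 <= b -> continuous f ->
  RLint b (fun s => c * f s) t = c * RLint b f t.
Proof.
rewrite le_eqVlt => /predU1P[<-|b0] cf; first by rewrite !RLint0.
rewrite /RLint gt_eqF// mulrCA; congr (_ * _).
by rewrite -RintegralZl//; [apply: eq_Rintegral => s _;
  rewrite mulrCA|exact: RLint_integrable].
Qed.

End RLint.

(** * Continuity of Riemann-Liouville integrals *)

Section RLint_continuous.
Variable R : realType.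
Implicit Types (a b p s t u M : R) (f g : R -> R).
Let mu := @lebesgue_measure R.

Lemma continuous_comp_max0 f : continuous f -> continuous (fun u =>
  f (Num.max u 0)).
Proof.
move=> cf u; apply: continuous_comp; last exact: cf.
by apply: continuous_max; [exact: cvg_id|exact: cvg_cst].
Qed.

Lemma continuous_fmax0 f : continuous f -> continuous (fun u =>
  Num.max (f u) 0).
Proof.
by move=> cf u; apply: continuous_max; [exact: cf|exact: cvg_cst].
Qed.

(** On [0, L] the kernel is at most e^L times the Gamma integrand. *)
Lemma kpow_integrable b L : 0 < b -> mu.-integrable `[0, L] (EFin \o kpow b).
Proof.
move=> b0; have mk := @measurable_kpow R b; apply/integrableP; split.
  by apply/measurable_EFinP; exact: measurable_funTS.
have g0 s : (0 <= (kpow b s * expR (- s))%:E)%E by exact: Gamma_integrand_ge0.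
have mg := @measurable_Gamma_integrand R b.
apply: (@le_lt_trans _ _ ((expR L)%:E * (Gamma b)%:E)%E);
  last by rewrite -EFinM ltry.
rewrite -integral_Gamma// -ge0_integralZl// ?lee_fin ?expR_ge0//.
apply: (@le_trans _ _ (\int[mu]_(s in `[0%R, L])
  ((expR L)%:E * (kpow b s * expR (- s))%:E))%E).
  apply: ge0_le_integral => //.
  - by apply/measurable_EFinP; apply: measurable_funTS; exact: measurableT_comp.
  - by apply: measurable_funTS; apply: emeasurable_funM.
  move=> s; rewrite /= in_itv/= => /andP[_ sL].
  rewrite -EFinM lee_fin ger0_norm ?kpow_ge0// mulrCA ler_peMr ?kpow_ge0//.
  by rewrite -expRD -[leLHS]expR0 ler_expR subr_ge0.
apply: ge0_subset_integral => //.
- by apply: emeasurable_funM.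
- by move=> s _; rewrite mule_ge0// lee_fin expR_ge0.
Qed.

(** Commuting the convolution moves the singularity to y = 0. Any [L] above [t] will do, since for y
    > t the truncated argument gives f 0 = 0; one domain thus serves all nearby [t]. *)
Lemma RLint_convolution b f t L : 0 < b -> continuous f ->
  (forall x, 0 <= f x) ->
  f 0 = 0 -> t <= L ->
  RLint b f t = (Gamma b)^-1 * \int[mu]_(y in `[0, L]) (f (Num.max (t - y) 0)
    * kpow b y).
Proof.
move=> b0 cf f0 f00 tL; have mf := continuous_measurable_fun cf.
rewrite RLint_convol// (convolC (@measurable_ekpow R b) (measurable_epos mf));
  last 2 first.
- exact: ekpow_ge0.
- by move=> x; exact: epos_ge0.
rewrite /Rintegral; congr (_ * fine _); rewrite [RHS]integral_mkcond.
apply: eq_integral => s _; rewrite patchE /ekpow /epos /kpow subr_gt0 -EFinM.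
have [|] := boolP (s \in `[0, L]%classic).
  rewrite inE/= in_itv/= => /andP[s0 sL]; case: ltP => st.
    by rewrite max_l ?subr_ge0 ?ltW.
  by rewrite max_r ?subr_le0// f00.
rewrite notin_setE/= in_itv/= => /negP; rewrite negb_and -!ltNge => /orP[s0|sL].
  by rewrite (ltNge 0 s) ltW// mulr0.
by rewrite ltNge (le_trans tL (ltW sL))/= mul0r.
Qed.

(* After the substitution [s = t - y] the singular kernel no longer depends on
   [t]; the assumption [f 0 = 0] makes the truncated [f] continuous. *)
Lemma continuous_RLint_ge0 b f : 0 < b -> continuous f ->
  (forall x, 0 <= f x) ->
  f 0 = 0 -> continuous (RLint b f).
Proof.
move=> b0 cf f0 f00 t0; pose L := `|t0| + 1.
have [M M0 fM] := continuous_bounded_segment L cf.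
have cp := continuous_comp_max0 cf.
have mp := continuous_measurable_fun cp.
have L0 : 0 <= L by rewrite addr_ge0.
have ub x y : x \in `]t0 - 1, t0 + 1[ -> 0 <= y ->
    `|f (Num.max (x - y) 0) * kpow b y| <= M * kpow b y.
  rewrite in_itv/= => /andP[_ xt] y0.
  rewrite normrM [X in _ * X <= _]ger0_norm ?kpow_ge0// ler_wpM2r ?kpow_ge0//.
  apply: fM; rewrite le_max lexx orbT/= ge_max L0 andbT lerBlDr.
  by rewrite (le_trans (ltW xt))// /L -addrA lerD ?ler_norm ?lerDl.
have gi : mu.-integrable `[0, L] (EFin \o (fun y => M * kpow b y)).
  have := @integrableZl _ _ _ mu _ _ M _ (kpow_integrable L b0).
  by apply; exact: measurable_itv.
have ci : {in (`]t0 - 1, t0 + 1[%classic : set R), continuous (fun x =>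
    \int[mu]_(y in `[0, L]) (f (Num.max (x - y) 0) * kpow b y))}.
  have mL : measurable (`[0, L]%classic : set (measurableTypeR R))
    by exact: measurable_itv.
  apply: (@continuity_under_integral R _ _ mu
    (fun x y => f (Num.max (x - y) 0) * kpow b y) _ mL (t0 - 1) (t0 + 1)
      _ _ (fun y => M * kpow b y)) => //.
  - move=> x xt; apply: le_integrable gi => //.
      apply/measurable_EFinP; apply: measurable_funTS; apply: measurable_funM.
        by apply: (measurableT_comp mp); exact: measurable_funB.
      exact: measurable_kpow.
    move=> y /=; rewrite in_itv/= => /andP[y0 _]; rewrite lee_fin.
    by apply: le_trans (ler_norm _); exact: ub.
  - apply: aeW => y _ x _; apply: cvgMl;
    apply: (@continuous_comp _ _ _ (fun z : R => z - y) (fun u : R =>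
    f (Num.max u 0))); last exact: cp.
    by apply: cvgB; [exact: cvg_id|exact: cvg_cst].
  - move=> x xt; apply: aeW => y /=; rewrite in_itv/= => /andP[y0 _]; exact: ub.
have nt : \forall x \near t0, x \in `]t0 - 1, t0 + 1[.
  by apply: near_in_itvoo; rewrite in_itv/= ltrBlDr ltrDl ltr01.
have tI : t0 \in (`]t0 - 1, t0 + 1[%classic : set R).
  by rewrite inE/= in_itv/= ltrBlDr ltrDl ltr01.
have xL x : x \in `]t0 - 1, t0 + 1[ -> x <= L.
  rewrite in_itv/= => /andP[_ xt]; apply: (le_trans (ltW xt)).
  by rewrite lerD2r ler_norm.
pose F x := \int[mu]_(y in `[0, L]) (f (Num.max (x - y) 0) * kpow b y).
have cF : (Gamma b)^-1 * F x @[x --> t0] --> (Gamma b)^-1 * F t0.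
  by apply: cvgM; [exact: cvg_cst|exact: ci].
rewrite /continuous_at.
rewrite (RLint_convolution b0 cf f0 f00 (L := L)) ?xL//; last by move: tI;
  rewrite inE.
apply: cvg_trans cF; apply: near_eq_cvg; near=> x.
apply/esym/RLint_convolution => //; apply: xL; near: x; exact: nt.
Unshelve. all: by end_near. Qed.

End RLint_continuous.

(** * The semigroup law *)

Section semigroup.
Variable R : realType.
Implicit Types (a b p s t u M : R) (f g : R -> R).
Let mu := @lebesgue_measure R.

Lemma continuous_fcst (c : R) : continuous (fun _ : R => c).
Proof. by move=> x; exact: cvg_cst. Qed.

Lemma continuous_fadd f g : continuous f -> continuous g ->
  continuous (fun s => f s + g s).
Proof. by move=> cf cg s; apply: cvgD; [exact: cf|exact: cg]. Qed.

Lemma continuous_fmul f g : continuous f -> continuous g ->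
  continuous (fun s => f s * g s).
Proof. by move=> cf cg s; apply: cvgM; [exact: cf|exact: cg]. Qed.

Lemma continuous_fscale (c : R) f : continuous f -> continuous (fun s =>
  c * f s).
Proof. by move=> cf; apply: continuous_fmul => //; exact: continuous_fcst. Qed.

Lemma epos1 : epos (fun=> 1) = @ekpow R 1.
Proof.
by apply/funext => s; rewrite /epos /ekpow /kpow subrr powRr0.
Qed.

(** The constant 1, cut off at 0, is the kernel of order 1, so this is Euler's relation with
    Gamma(1) = 1. *)
Lemma RLint1 b t : 0 < b -> RLint b (fun=>
  1) t = kpow (b + 1) t / Gamma (b + 1).
Proof.
move=> b0; rewrite RLint_convol// epos1 convol_ekpow// Gamma1 /= mulr1.
by rewrite mulrA mulrA mulVf ?gt_eqF ?Gamma_gt0// mul1r mulrC.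
Qed.

(** Conventions at 0 agree: for b = 0 both sides are 1 since [powR] gives 0^0 = 1, and for b > 0
    both vanish at t = 0. *)
Lemma PhiE b t : 0 <= b -> 0 <= t -> Phi (b + 1) t = RLint b (fun=> 1) t.
Proof.
rewrite le_eqVlt => /predU1P[<- _|b0 t0].
  by rewrite RLint0 add0r /Phi subrr powRr0 Gamma1 divr1.
rewrite RLint1// /Phi /kpow addrK; case: ifPn => //.
by rewrite -leNgt => t1; rewrite (@le_anti _ _ t 0) ?t0 ?t1// powR0 ?gt_eqF.
Qed.

Lemma continuous_kpow b : 0 < b -> continuous (@kpow R (b + 1)).
Proof.
move=> b0 t; rewrite /continuous_at; have [t0|t0|t0] := ltgtP t 0.
- rewrite {2}/kpow ltNge ltW//=; apply: cvg_near_cst; near=> x;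
  rewrite /kpow ltNge ltW//=.
  by near: x; exact: lt_nbhsl.
- have := @continuous_powR_pos R b _ t0;
  rewrite /continuous_at {2}/kpow t0 addrK.
  apply: cvg_trans; apply: near_eq_cvg; near=> x; rewrite /kpow addrK ifT//.
  by near: x; exact: lt_nbhsr.
- rewrite t0 {2}/kpow ltxx; apply/cvgr0Pnorm_lt => e e0.
  have d0 : 0 < e `^ b^-1 by exact: powR_gt0.
  near=> x; rewrite ger0_norm ?kpow_ge0// /kpow; case: ifPn => // x0.
  have -> : e = (e `^ b^-1) `^ b.
    by rewrite -powRrM mulVf ?lt0r_neq0// powRr1// ltW.
  rewrite addrK gt0_ltr_powR ?nnegrE ?powR_ge0 ?(ltW x0)//.
  by near: x; exact: lt_nbhsl.
Unshelve. all: by end_near. Qed.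

Lemma continuous_RLint1 b : 0 <= b -> continuous (RLint b (fun=> 1 : R)).
Proof.
rewrite le_eqVlt => /predU1P[<-|b0].
  by rewrite RLint0; exact: continuous_fcst.
rewrite (_ : RLint b _ = (fun t => kpow (b + 1) t / Gamma (b + 1))).
  by move=> t; apply: cvgM; [exact: continuous_kpow|exact: cvg_cst].
by apply/funext => t; exact: RLint1.
Qed.

(** The function is f(0) plus the difference of the positive and negative parts of f - f(0). These
    parts are nonnegative and vanish at 0, as the previous case demands; the constant has an
    explicit integral. *)
Lemma continuous_RLint b f : 0 <= b -> continuous f -> continuous (RLint b f).
Proof.
rewrite le_eqVlt => /predU1P[<- cf|b0 cf].
  by rewrite RLint0.
have cB : continuous (fun s => f s - f 0 : R).
  by move=> s; apply: cvgB; [exact: cf|exact: cvg_cst].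
pose f1 s := Num.max (f s - f 0) 0; pose f2 s := Num.max (- (f s - f 0)) 0.
have c1 : continuous f1 by exact: (@continuous_fmax0 _ _ cB).
have c2 : continuous f2.
  apply: (@continuous_fmax0 _ (fun s => - (f s - f 0))) => s.
  by apply: cvgN; exact: cB.
have r1 : continuous (RLint b f1).
  by apply: continuous_RLint_ge0 => // [x|];
    rewrite /f1 ?subrr ?maxxx// le_max lexx orbT.
have r2 : continuous (RLint b f2).
  by apply: continuous_RLint_ge0 => // [x|];
    rewrite /f2 ?subrr ?oppr0 ?maxxx// le_max lexx orbT.
have fE : f = (fun s => f 0 * 1 + (f1 s + (-1) * f2 s)).
  apply/funext => s; rewrite /f1 /f2; case: (leP (f s - f 0) 0) => h.
    by rewrite max_l ?oppr_ge0//; ring.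
  by rewrite max_r ?oppr_le0 ?ltW//; ring.
rewrite fE (_ : RLint b _ = fun t => f 0 * RLint b (fun=>
  1) t + (RLint b f1 t + (-1) * RLint b f2 t)).
  apply: continuous_fadd; first by apply: continuous_fscale;
    exact: continuous_RLint1 (ltW b0).
  by apply: continuous_fadd => //; apply: continuous_fscale.
apply/funext => t; rewrite !RLintD ?RLintZ ?ltW//.
all: by do !first [assumption | exact: continuous_fcst | apply: continuous_fadd
  | apply: continuous_fscale].
Qed.

Lemma convol_RLint b f t : 0 < b -> continuous f ->
  convol (ekpow b) (epos f) t = (Gamma b * RLint b f t)%:E.
Proof.
move=> b0 cf; have mf := continuous_measurable_fun cf.
rewrite RLint_convol// mulrA divff ?mul1r ?lt0r_neq0 ?Gamma_gt0// fineK//.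
rewrite convol_epos//; apply: integrable_fin_num; first exact: measurable_itv.
exact: RLint_integrable.
Qed.

Lemma RLint_semigroup_ge0 a b f t : 0 < a -> 0 < b -> continuous f ->
  (forall x, 0 <= f x) -> RLint a (RLint b f) t = RLint (a + b) f t.
Proof.
move=> a0 b0 cf f0; have mf := continuous_measurable_fun cf.
have [ga gb gab] := And3 (Gamma_gt0 a0) (Gamma_gt0 b0)
  (Gamma_gt0 (addr_gt0 a0 b0)).
have mp := measurable_epos mf; have p0 x : (0 <= epos f x)%E by exact: epos_ge0.
have /(congr1 (@^~ t)) := convolA (@measurable_ekpow R a)
  (@measurable_ekpow R b) mp
  (@ekpow_ge0 R a) (@ekpow_ge0 R b) p0.
rewrite (_ : convol (ekpow a) (ekpow b) = (fun x =>
  (Gamma a * Gamma b / Gamma (a + b))%:E * ekpow (a + b) x)%E); last first.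
  by apply/funext => x; exact: convol_ekpow.
have c0 : (0 <= (Gamma a * Gamma b / Gamma (a + b))%:E)%E.
  by rewrite lee_fin; exact: divr_ge0 (mulr_ge0 (ltW ga) (ltW gb)) (ltW gab).
rewrite (convolZl t (@measurable_ekpow R (a + b)) mp (@ekpow_ge0 R (a + b))
  p0 c0).
have e0 x : (0 <= epos (RLint b f) x)%E.
  rewrite /epos lee_fin; case: ifP => // _; rewrite /RLint gt_eqF//.
  rewrite mulr_ge0 ?invr_ge0 ?(ltW gb)//; apply: Rintegral_ge0 => s _.
  by rewrite mulr_ge0 ?powR_ge0.
have cr := continuous_RLint (ltW b0) cf.
rewrite (_ : convol (ekpow b) (epos f) = (fun x =>
  (Gamma b)%:E * epos (RLint b f) x)%E); last first.
  apply/funext => x; rewrite convol_RLint// /epos EFinM; case: ifPn => //.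
  by rewrite -leNgt => x0; rewrite RLint_neg.
have gb' : (0 <= (Gamma b)%:E)%E by rewrite lee_fin; exact: ltW gb.
have me := measurable_epos (continuous_measurable_fun cr).
rewrite (convolZr t (@measurable_ekpow R a) me (@ekpow_ge0 R a) e0 gb').
rewrite (convol_RLint _ a0 cr) (convol_RLint _ (addr_gt0 a0 b0) cf) -!EFinM =>
  -[h].
apply: (mulfI (lt0r_neq0 (mulr_gt0 ga gb))); rewrite -mulrA mulrCA h.
by rewrite mulrA divfK ?lt0r_neq0.
Qed.

(** Only values on [0, t] matter, where [f] is bounded by some [M]: there [f] is the nonnegative
    function [h] minus M times 1, and the nonnegative case applies to [h] and to 1. *)
Lemma RLint_semigroup a b f t : 0 <= a -> 0 <= b -> continuous f ->
  RLint a (RLint b f) t = RLint (a + b) f t.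
Proof.
rewrite le_eqVlt => /predU1P[<- _ _|a0]; first by rewrite add0r RLint0.
rewrite le_eqVlt => /predU1P[<- _|b0 cf].
  by rewrite addr0 RLint0.
have ab0 := addr_gt0 a0 b0.
have [t0|t0] := leP t 0; first by rewrite !RLint_neg.
have [M M0 fM] := continuous_bounded_segment t cf.
pose h s := Num.max (f s + M * 1) 0.
have c1 : continuous (fun _ : R => 1 : R) by exact: continuous_fcst.
have cM : continuous (fun s => f s + M * 1).
  by apply: continuous_fadd => //; exact: continuous_fscale.
have ch : continuous h by exact: continuous_fmax0.
have h0 x : 0 <= h x by rewrite /h le_max lexx orbT.
have hE s : 0 <= s <= t -> h s = f s + M * 1.
  move=> /fM; rewrite ler_norml => /andP[fs _].
  by rewrite /h max_l// mulr1 -lerBlDr sub0r.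
have RE c s : 0 < c -> 0 <= s <= t ->
  RLint c f s = RLint c h s + (- M) * RLint c (fun=> 1) s.
  move=> c0 /andP[s0 st]; rewrite (@eq_RLint _ c h (fun s =>
    f s + M * 1)) ?(ltW c0)//.
    rewrite RLintD ?RLintZ ?(ltW c0)//; last exact: continuous_fscale.
    by ring.
  by move=> u /andP[u0 us]; rewrite hE// u0 (le_trans us).
rewrite (RE (a + b)) ?lexx ?(ltW t0)//.
rewrite (@eq_RLint _ a _ (fun s => RLint b h s + (- M) * RLint b (fun=>
  1) s)) ?(ltW t0) ?(ltW a0)//; last first.
  by move=> s st; exact: RE.
have [rh r1] := (continuous_RLint (ltW b0) ch, continuous_RLint (ltW b0) c1).
rewrite RLintD ?RLintZ ?(ltW a0)//; last exact: continuous_fscale.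
by rewrite !RLint_semigroup_ge0.
Qed.

End semigroup.

(** * Differentiation on a segment *)

(** The retraction of the line onto [0, T]: composing with it makes a function continuous on [0, T]
    continuous everywhere. *)
Definition clamp (R : realType) (T t : R) : R := Num.min (Num.max t 0) T.

Section segment.
Variable R : realType.
Implicit Types (a b p s t u M T : R) (f g : R -> R).

Lemma cvg_dnbhs_shift (x c : R) : s + c @[s --> x^'] --> (x + c)^'.
Proof.
move=> A; rewrite /dnbhs /within/= => /nbhs_ballP[e /= e0 hA].
apply/nbhs_ballP; exists e => //= s; rewrite /ball/= => xs sx; apply: hA.
  by rewrite /ball/= opprD addrACA subrr addr0.
by rewrite (inj_eq (addIr c)).
Qed.

Lemma cvg_dquot_derive f t (l : R) :
  dquot f t s @[s --> t^'] --> l <-> is_derive t 1 f l.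
Proof.
pose q h := h^-1 *: ((f \o shift t) (h *: (1 : R)) - f t).
have qE h : q h = dquot f t (h + t).
  by rewrite /q /dquot /= /GRing.scale /= mulr1 addrK mulrC.
split=> [h|[dv <-]].
  have ql : q h @[h --> 0^'] --> l.
    have /cvg_trans : q h @[h --> 0^'] `=>` dquot f t (h + t) @[h --> 0^'].
      by rewrite (_ : q = fun h => dquot f t (h + t))//; apply/funext.
    apply; apply: cvg_comp h.
    by have := @cvg_dnbhs_shift 0 t; rewrite add0r.
  apply: DeriveDef; first by apply/cvg_ex; exists l.
  exact: cvg_lim ql.
have ql : q h @[h --> 0^'] --> 'D_1 f t by exact: dv.
rewrite (_ : dquot f t = fun s => q (s - t)); last first.
  by apply/funext => s; rewrite qE subrK.
apply: (@cvg_comp _ _ _ (fun s => s - t) q) ql.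
by have := @cvg_dnbhs_shift t (- t); rewrite subrr.
Qed.

Lemma within_seg_dnbhs T t : 0 < t < T -> within `[0, T] t^' = t^'.
Proof.
move=> tT; have tI : \forall s \near t^', `[0, T]%classic s.
  apply: nbhs_dnbhs; near=> s; rewrite /= in_itv/=; apply/andP; split;
    apply/ltW.
    by near: s; apply: lt_nbhsr; case/andP: tT.
  by near: s; apply: lt_nbhsl; case/andP: tT.
apply/seteqP; split => A /= hA; last by apply: filterS hA.
by apply: filterS2 tI hA => s ? ; exact.
Unshelve. all: by end_near. Qed.

(** [lim] identifies a limit only along a proper filter. A nearby point of the segment is found by
    moving away from the closer end; the cap T / 2 on the step keeps it inside. *)
Lemma within_seg_proper T t : 0 < T -> 0 <= t <= T ->
  ProperFilter (within `[0, T] t^').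
Proof.
move=> T0 /andP[t0 tT]; apply: Build_ProperFilter_ex => A.
rewrite /dnbhs /within/= => /nbhs_ballP[e /= e0 hA].
pose d := Num.min (e / 2) (T / 2).
have d0 : 0 < d by rewrite lt_min !divr_gt0.
have de : d < e by rewrite gt_min; apply/orP; left; lra.
have dT : d <= T / 2 by rewrite ge_min lexx orbT.
have [tT2|tT2] := leP t (T / 2).
  exists (t + d); apply: hA.
  - by rewrite /ball/= opprD addrA subrr add0r normrN gtr0_norm.
  - by rewrite -subr_eq0 addrC addKr gt_eqF.
  - by rewrite in_itv/=; lra.
exists (t - d); apply: hA.
- by rewrite /ball/= opprB addrCA subrr addr0 gtr0_norm.
- by rewrite -subr_eq0 addrAC subrr add0r oppr_eq0 gt_eqF.
- by rewrite in_itv/=; lra.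
Qed.

Lemma cvg_dquot_eq T f g t (l : R) : 0 <= t <= T ->
  (forall s, 0 <= s <= T -> f s = g s) ->
  dquot f t s @[s --> within `[0, T] t^'] --> l ->
  dquot g t s @[s --> within `[0, T] t^'] --> l.
Proof.
move=> tT fg h A /h hA; apply: (@filterS _ t^' _ _ _ _ hA) => s /= hs sT.
have := hs sT.
by move: sT; rewrite in_itv/= => sT; rewrite /dquot (fg s)// (fg t).
Qed.

Lemma derive_segP T f t (l : R) : 0 < T -> 0 <= t <= T ->
  dquot f t s @[s --> within `[0, T] t^'] --> l -> derive_seg T f t = l.
Proof.
move=> T0 tT fl; have ? := within_seg_proper T0 tT; exact: cvg_lim fl.
Qed.

Lemma clamp_id T t : 0 <= t <= T -> clamp T t = t.
Proof. by move=> /andP[t0 tT]; rewrite /clamp max_l// min_l. Qed.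

Lemma clamp_in T t : 0 < T -> 0 <= clamp T t <= T.
Proof.
by move=> T0; rewrite /clamp le_min le_max lexx orbT/= (ltW T0)/=
  ge_min lexx orbT.
Qed.

Lemma continuous_clamp T : continuous (@clamp R T).
Proof.
move=> t; apply: (@continuous_min _ _ (fun t => Num.max t 0) (fun=> T));
  last exact: cvg_cst.
by apply: continuous_max; [exact: cvg_id|exact: cvg_cst].
Qed.

Lemma continuous_comp_clamp T f : 0 < T -> {within `[0, T], continuous f} ->
  continuous (f \o clamp T).
Proof.
move=> T0 cf t; have cI : `[0, T]%classic (clamp T t)
  by rewrite /= in_itv/= clamp_in.
apply: (@cvg_comp _ _ _ (clamp T) f _ (within `[0, T] (nbhs (clamp T t)))).
  move=> A hA; have := @continuous_clamp T t _ hA.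
  move=> hB; apply: (@filterS _ (nbhs t) _ _ _ _ hB) => s /= h; apply: h.
  by rewrite in_itv/= clamp_in.
have E := nbhs_subspace_in cI.
move=> B /(cf (clamp T t)); rewrite /nbhs/= /fmap/= E; exact.
Qed.

Lemma within_continuous_eq T f g : continuous g ->
  (forall s, 0 <= s <= T -> f s = g s) -> {within `[0, T], continuous f}.
Proof.
move=> cg fg; apply: (@subspace_eq_continuous _ _ _ g).
  by move=> s; rewrite inE/= in_itv/= => sT; exact/esym/fg.
exact: continuous_subspaceT.
Qed.

End segment.

(* The functions [F k] extend the derivatives of [y] on [0, T] continuously to
   the whole line, the relation between them being stated in integral form. *)
Definition tower (R : realType) (T : R) (n : nat) (y : R -> R)
    (F : nat -> R -> R) : Prop :=
  [/\ forall k, (k <= n)%N -> continuous (F k),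
      forall t, 0 <= t <= T -> y t = F 0%N t
    & forall k t, (k < n)%N -> 0 <= t <= T ->
        F k t = F k 0 + RLint 1 (F k.+1) t].

Section FTC.
Variable R : realType.
Implicit Types (a b p s t u M T : R) (f g y : R -> R) (F : nat -> R -> R).
Let mu := @lebesgue_measure R.

Lemma continuous_integrable_segment f a b : continuous f ->
  mu.-integrable `[a, b] (EFin \o f).
Proof.
move=> cf; apply: continuous_compact_integrable; first exact: segment_compact.
exact: continuous_subspaceT.
Qed.

Lemma RLint_1E f t : RLint 1 f t = \int[mu]_(s in `[0, t]) f s.
Proof.
rewrite /RLint oner_eq0 Gamma1 invr1 mul1r; apply: eq_Rintegral => s _.
by rewrite subrr powRr0 mul1r.
Qed.

(** [RLint 1 f] vanishes on the left of 0 and may have a corner there. A primitive starting at -1 is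
    differentiable at 0 as well, which yields the one-sided derivative at that end. *)
Lemma RLint_1_primitive f : continuous f -> exists G : R -> R,
  (forall t, -1 < t -> is_derive t 1 G (f t)) /\
  forall t, 0 <= t -> RLint 1 f t = G t - G 0.
Proof.
move=> cf; pose G x := \int[mu]_(s in `[-1, x]) f s; exists G; split=> t t0.
  have t1 : t < t + 1 by rewrite ltrDl.
  have [dG GE] := continuous_FTC1_closed t1
    (continuous_integrable_segment (-1) (t + 1) cf) t0 (cf t).
  by apply: DeriveDef; [exact: dG|rewrite -derive1E; exact: GE].
rewrite RLint_1E -Rintegral_itv_obnd_cbnd; last first.
  have := continuous_integrable_segment 0 t cf.
  apply: integrableS => //; exact: subset_itv_oc_cc.
rewrite -(@Rintegral_itvB _ f (BLeft (-1)) (BRight t) 0)//.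
- exact: continuous_integrable_segment.
- by rewrite bnd_simp; lra.
Qed.

Lemma is_derive_RLint_1 f t : continuous f -> 0 < t ->
  is_derive t 1 (RLint 1 f) (f t).
Proof.
move=> cf t0; have [G [dG GE]] := RLint_1_primitive cf.
apply: (@near_eq_is_derive _ _ _ (fun x => G x - G 0)).
  near=> x; rewrite GE// ltW//; near: x; exact: lt_nbhsr.
have d : is_derive t 1 G (f t) by apply: dG; lra.
by apply: is_derive_eq; rewrite subr0.
Unshelve. all: by end_near. Qed.

Lemma cvg_dquot_RLint_1 f t T (c : R) : continuous f -> 0 <= t <= T ->
  dquot (fun x => c + RLint 1 f x) t s @[s --> within `[0, T] t^'] --> f t.
Proof.
move=> cf tT; have [G [dG GE]] := RLint_1_primitive cf.
apply: (@cvg_dquot_eq _ _ (fun x => c + (G x - G 0))) => //.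
  by move=> s /andP[s0 _]; rewrite GE.
apply: cvg_within_filter; apply/cvg_dquot_derive.
have d : is_derive t 1 G (f t) by apply: dG; case/andP: tT => ? _; lra.
by apply: is_derive_eq; rewrite add0r mul1r subr0.
Qed.

Lemma FTC_RLint T (h f : R -> R) : continuous h -> continuous f ->
  (forall t, 0 < t < T -> is_derive t 1 h (f t)) ->
  forall t, 0 <= t <= T -> h t = h 0 + RLint 1 f t.
Proof.
move=> ch cf dh t /andP[]; rewrite le_eqVlt => /predU1P[<- _|t0 tT].
  by rewrite RLint_neg// addr0.
rewrite RLint_1E /Rintegral (@continuous_FTC2 _ _ h)//=.
- by rewrite addrCA subrr addr0.
- exact: continuous_subspaceT.
- split.
  + move=> x; rewrite in_itv/= => /andP[x0 xt].
    by apply: ex_derive; apply: dh; rewrite x0 (lt_le_trans xt).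
  + by apply: cvg_at_right_filter; exact: ch.
  + by apply: cvg_at_left_filter; exact: ch.
- move=> x; rewrite in_itv/= => /andP[x0 xt]; rewrite derive1E.
  by apply: derive_val; apply: dh; rewrite x0 (lt_le_trans xt).
Qed.

Lemma tower_cvg_dquot T n y F k t : tower T n y F -> (k < n)%N -> 0 <= t <= T ->
  dquot (F k) t s @[s --> within `[0, T] t^'] --> F k.+1 t.
Proof.
move=> [cF _ FE] kn tT.
apply: (@cvg_dquot_eq _ _ (fun x => F k 0 + RLint 1 (F k.+1) x)) => //.
  by move=> s sT; rewrite [RHS]FE.
by apply: cvg_dquot_RLint_1 => //; exact: cF.
Qed.

Lemma tower_derive_segn T n y F k t : 0 < T -> tower T n y F -> (k <= n)%N ->
  0 <= t <= T -> derive_segn T k y t = F k t.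
Proof.
move=> T0 yF; elim: k t => [|k IH] t kn tT; first by have [_ yE _] := yF;
  exact: yE.
rewrite /derive_segn iterS; apply: derive_segP => //.
apply: (@cvg_dquot_eq _ _ (F k)) => //; last exact: tower_cvg_dquot yF _ _.
by move=> s sT; rewrite -IH// ltnW.
Qed.

Lemma tower_Ck T n y F : 0 < T -> tower T n y F -> Ck T n y.
Proof.
move=> T0 yF; split=> [k t kn tT|k kn].
  apply/cvg_ex; exists (F k.+1 t).
  apply: (@cvg_dquot_eq _ _ (F k)) => //; last exact: tower_cvg_dquot yF _ _.
  by move=> s sT; rewrite (tower_derive_segn _ yF)// ltnW.
have [cF _ _] := yF; apply: within_continuous_eq (cF _ kn) _ => s sT.
exact: (tower_derive_segn _ yF).
Qed.

Lemma tower_is_derive T n y F k t : tower T n y F -> (k < n)%N -> 0 < t < T ->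
  is_derive t 1 (F k) (F k.+1 t).
Proof.
move=> yF kn tT; apply/cvg_dquot_derive; rewrite -(within_seg_dnbhs tT).
by apply: tower_cvg_dquot yF _ _ => //; case/andP: tT => /ltW-> /ltW->.
Qed.

Lemma near_itvoo T t : 0 < t < T -> \forall x \near t, 0 < x < T.
Proof.
move=> /andP[t0 tT]; near=> x; apply/andP; split; near: x.
  exact: lt_nbhsr.
exact: lt_nbhsl.
Unshelve. all: by end_near. Qed.

Lemma tower_derive1n T n y F k t : tower T n y F -> (k <= n)%N -> 0 < t < T ->
  derive1n k y t = F k t.
Proof.
move=> yF; elim: k t => [|k IH] t kn tT.
  by have [_ yE _] := yF; apply: yE; case/andP: tT => /ltW-> /ltW->.
rewrite derive1nS derive1E; have := tower_is_derive yF kn tT.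
have e : \near t, F k t = derive1n k y t.
  by near=> x; rewrite IH ?(ltnW kn)//; near: x; exact: near_itvoo.
by move=> /(near_eq_is_derive e)[_].
Unshelve. all: by end_near. Qed.

Lemma tower_derivable T n y F k t : tower T n y F -> (k < n)%N -> 0 < t < T ->
  derivable (derive1n k y) t 1.
Proof.
move=> yF kn tT; have := tower_is_derive yF kn tT.
have e : \near t, F k t = derive1n k y t.
  by near=> x; rewrite (tower_derive1n yF) ?(ltnW kn)//; near: x;
    exact: near_itvoo.
by move=> /(near_eq_is_derive e)[].
Unshelve. all: by end_near. Qed.

(** Induction through integrals of order 1 and the primitive of a monomial, which avoids evaluating
    Gamma at integers. *)
Lemma RLint_nat1 (n : nat) t : 0 <= t -> RLint n%:R (fun=>
  1) t = t ^+ n / n`!%:R.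
Proof.
elim: n t => [|n IH] t t0; first by rewrite RLint0 expr0 fact0 divr1.
have n0 : (n.+1`!%:R : R) != 0 by rewrite pnatr_eq0 -lt0n fact_gt0.
rewrite -[n.+1%:R]natr1 addrC -RLint_semigroup ?ler0n//;
  last exact: continuous_fcst.
pose h x := x ^+ n.+1 / n.+1`!%:R : R.
have ch k c : continuous (fun x : R => x ^+ k / c).
  by move=> x; apply: cvgM; [exact: exprn_continuous|exact: cvg_cst].
have dh x : 0 < x < t -> is_derive x 1 h (x ^+ n / n`!%:R).
  move=> _; rewrite (_ : h = (fun x : R => n.+1`!%:R^-1 *: x ^+ n.+1));
    last first.
    by apply/funext => z; rewrite /h mulrC.
  have d : is_derive x 1 (@GRing.exp R ^~ n.+1) (n.+1%:R * x ^+ n).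
    apply: DeriveDef; first exact: exprn_derivable.
    by rewrite exp_derive /GRing.scale/= mulr1.
  have nf : (n`!%:R : R) != 0 by rewrite pnatr_eq0 -lt0n fact_gt0.
  have n1 : (n.+1%:R : R) != 0 by rewrite pnatr_eq0.
  rewrite (_ : x ^+ n / n`!%:R = n.+1`!%:R^-1 *: (n.+1%:R * x ^+ n)).
    exact: is_deriveZ.
  rewrite /GRing.scale/= factS natrM invfM mulrACA.
  by rewrite mulVf// mul1r mulrC.
have tt : 0 <= t <= t by rewrite t0 lexx.
have := FTC_RLint (ch _ _) (ch _ _) dh tt; rewrite /h expr0n mul0r add0r => ->.
by apply: eq_RLint => // s /andP[s0 _]; exact: IH.
Qed.

(** Taylor's formula with integral remainder: in F k = F k 0 + I^1 (F k.+1), the operator I^k turns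
    the constant into the next Taylor term, which cancels. *)
Lemma tower_taylor T n y F k t : 0 < T -> tower T n y F -> (k <= n)%N ->
  0 <= t <= T -> taylor_rem T k y t = RLint k%:R (F k) t.
Proof.
move=> T0 yF; have [cF yE FE] := yF.
elim: k => [|k IH] kn tT.
  by rewrite /taylor_rem big_geq// subr0 RLint0 yE.
have [t0 _] := andP tT.
rewrite /taylor_rem big_nat_recr//= opprD addrA -/(taylor_rem T k y t)
  IH ?(ltnW kn)//.
have T00 : 0 <= (0:R) <= T by rewrite lexx ltW.
rewrite (tower_derive_segn _ yF) ?(ltnW kn)//.
have c1 : continuous (fun _ : R => 1 : R) by exact: continuous_fcst.
have cr : continuous (RLint 1 (F k.+1)) by apply: continuous_RLint => //;
  exact: cF.
rewrite (@eq_RLint _ _ _ (fun s => F k 0 * 1 + RLint 1 (F k.+1) s)) ?ler0n//;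
  last first.
  by move=> s /andP[s0 st]; rewrite mulr1 FE// s0 (le_trans st)//;
    case/andP: tT.
rewrite RLintD ?RLintZ ?ler0n//; last exact: continuous_fscale.
rewrite RLint_nat1// RLint_semigroup ?ler0n//; last exact: cF.
by rewrite natr1; ring.
Qed.

Lemma Ck_tower T n y : 0 < T -> Ck T n y ->
  tower T n y (fun k => derive_segn T k y \o clamp T).
Proof.
move=> T0 [dy cy]; have cF k : (k <= n)%N ->
  continuous (derive_segn T k y \o clamp T).
  by move=> kn; apply: continuous_comp_clamp => //; exact: cy.
split=> [//|t tT|k t kn tT]; first by rewrite /= clamp_id.
apply: FTC_RLint tT; [exact/cF/ltnW|exact: cF|].
move=> s sT; apply/cvg_dquot_derive; rewrite -(within_seg_dnbhs sT).
have sT' : 0 <= s <= T by case/andP: sT => /ltW-> /ltW->.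
apply: (@cvg_dquot_eq _ _ (derive_segn T k y)) => //.
  by move=> x xT; rewrite /= clamp_id.
have /cvg_ex[l hl] := dy k s kn sT'.
suff -> : (derive_segn T k.+1 y \o clamp T) s = l by [].
by rewrite /= clamp_id//; exact: derive_segP T0 sT' hl.
Qed.

End FTC.

Local Opaque RLint Phi.

(** * Caputo derivatives *)

Section Caputo.
Variable R : realType.
Implicit Types (a b p s t u M T : R) (f g y : R -> R) (F : nat -> R -> R).

(** Carries identities known only on ]0, T[, such as (E), to the end points. *)
Lemma eq_segment_closure T f g t : 0 < T -> continuous f -> continuous g ->
  (forall s, 0 < s < T -> f s = g s) -> 0 <= t <= T -> f t = g t.
Proof.
move=> T0 cf cg fg /andP[]; rewrite le_eqVlt => /predU1P[<- _|t0].
  apply: (@cvg_unique _ (@norm_hausdorff _ R) (f x @[x --> 0^'+])).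
    by apply: cvg_at_right_filter; exact: cf.
  have : g x @[x --> 0^'+] --> g 0 by apply: cvg_at_right_filter; exact: cg.
  apply: cvg_trans; apply: near_eq_cvg; near=> x; rewrite fg//.
  by apply/andP; split; near: x; [exact: nbhs_right_gt|exact: nbhs_right_lt].
rewrite le_eqVlt => /predU1P[->|tT]; last by rewrite fg// t0 tT.
apply: (@cvg_unique _ (@norm_hausdorff _ R) (f x @[x --> T^'-])).
  by apply: cvg_at_left_filter; exact: cf.
have : g x @[x --> T^'-] --> g T by apply: cvg_at_left_filter; exact: cg.
apply: cvg_trans; apply: near_eq_cvg; near=> x; rewrite fg//.
by apply/andP; split; near: x; [exact: nbhs_left_gt|exact: nbhs_left_lt].
Unshelve. all: by end_near. Qed.

Lemma tower_RLint T n f v : continuous v ->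
  (forall t, 0 <= t <= T -> f t = RLint n%:R v t) ->
  tower T n f (fun k => RLint (n - k)%:R v).
Proof.
move=> cv fE; split=> [k _|t tT|k t kn tT]; first exact: continuous_RLint.
  by rewrite subn0 fE.
have nk : 0 < (n - k)%:R :> R by rewrite ltr0n subn_gt0.
have e : 1 + (n - k.+1)%:R = (n - k)%:R :> R by rewrite addrC natr1 subnSK.
rewrite (RLint_neg v nk (lexx 0)) add0r.
by rewrite (RLint_semigroup _ ler01 (ler0n R _) cv) e.
Qed.

(** If the complementary integral is an n-fold integral of [v], its tower supplies at once the
    existence of the [n] derivatives and the value [v]. *)
Lemma RLderivP T b (n : nat) f v : dorder b = n -> continuous v ->
  (forall t, 0 <= t <= T -> RLint (n%:R - b) f t = RLint n%:R v t) ->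
  RLderivable T b f /\ forall t, 0 < t < T -> RLderiv b f t = v t.
Proof.
move=> bn cv fE; have tw := tower_RLint cv fE; rewrite /RLderivable /RLderiv bn.
split=> [k t kn tT|t tT]; first exact: tower_derivable tw kn tT.
by rewrite (tower_derive1n tw)// subnn RLint0.
Qed.

Lemma dorderE b (n : nat) : n%:R - 1 < b <= n%:R -> dorder b = n.
Proof.
move=> h; rewrite /dorder (_ : Num.ceil b = n%:Z)//.
by apply: ceil_def; rewrite intrB.
Qed.

Lemma Phi_nat (j : nat) t : 0 <= t -> Phi j.+1%:R t = RLint j%:R (fun=> 1) t.
Proof. by move=> t0; rewrite -(natr1 j) (PhiE (ler0n R j) t0). Qed.

Lemma RLint_nat1_0 (n : nat) : RLint n%:R (fun=> 1) 0 = (n == 0)%:R :> R.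
Proof. by rewrite RLint_nat1// expr0n; case: n => [|n];
  rewrite ?fact0 ?divr1// mul0r. Qed.

(** The k-th derivative of Phi_{j+1} is Phi_{j+1-k}, written as an integral of 1, and is 0 for k >
    j. The indicator is essential since [j - k] is truncated to 0 in that case. *)
Lemma solution_tower T al (N j : nat) g y : N%:R < al -> (j <= N)%N ->
  continuous g ->
  (forall t, 0 <= t <= T -> y t = Phi j.+1%:R t + RLint al g t) ->
  tower T N y (fun k t => (k <= j)%:R * RLint (j - k)%:R (fun=> 1) t
                          + RLint (al - k%:R) g t).
Proof.
move=> Nal jN cg yE.
have kal k : (k <= N)%N -> 0 < al - k%:R.
  by move=> kN; rewrite subr_gt0 (le_lt_trans _ Nal)// ler_nat.
split=> [k kN|t tT|k t kN tT].
- apply: continuous_fadd; last by apply: continuous_RLint => //; exact/ltW/kal.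
  by apply: continuous_fscale; apply: continuous_RLint => //;
    exact: continuous_fcst.
- have [t0 _] := andP tT.
  by rewrite (yE _ tT) (Phi_nat _ t0) leq0n mul1r subn0 (subr0 al).
have [t0 _] := andP tT.
have c1 : continuous (fun _ : R => 1 : R) by exact: continuous_fcst.
have kal' : 0 <= al - k.+1%:R by exact/ltW/kal.
have crg : continuous (RLint (al - k.+1%:R) g) by exact: continuous_RLint.
have cr1 : continuous (RLint (j - k.+1)%:R (fun=>
  1 : R)) by exact: continuous_RLint.
rewrite RLintD//; last exact: continuous_fscale.
rewrite (RLintZ _ _ ler01 cr1) (RLint_semigroup _ ler01 (ler0n R _) c1).
rewrite (RLint_semigroup _ ler01 kal' cg) (RLint_neg g (kal _ (ltnW kN))
  (lexx 0)).
have e1 : 1 + (al - k.+1%:R) = al - k%:R by rewrite -natr1; ring.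
rewrite e1 (RLint_nat1_0 (j - k)) subn_eq0; move: (RLint (al - k%:R) g t) => G.
(* The constant of integration [k <= j][j <= k] is 1 exactly for k = j, where Phi_1 = 1 has
   derivative 0. *)
suff -> : (k <= j)%:R * RLint (j - k)%:R (fun=> 1) t =
    (k <= j)%:R * (j <= k)%:R + (k.+1 <= j)%:R * RLint (1 + (j - k.+1)%:R)
      (fun=> 1) t.
  by move: (_ * RLint _ _ _) (_ * _) => x z; rewrite addr0 addrA.
case: (ltngtP k j) => kj.
- have e2 : 1 + (j - k.+1)%:R = (j - k)%:R :> R by rewrite addrC natr1 subnSK.
  by rewrite e2 mulr0 add0r.
- by rewrite !mul0r (addr0 0).
- by rewrite kj subnn mul0r addr0 mulr1 mul1r RLint0.
Qed.

End Caputo.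

(** * Functions Phi_{j+1} + I^al g: regularity, initial data, Caputo derivatives *)

Section solution.
Variable R : realType.
Variables (T al : R) (N j : nat) (g y : R -> R).
Hypotheses (T0 : 0 < T) (Nal : N%:R < al <= N.+1%:R) (jN : (j <= N)%N).
Hypothesis cg : continuous g.
Hypothesis yE : forall t, 0 <= t <= T -> y t = Phi j.+1%:R t + RLint al g t.

Let F k t := (k <= j)%:R * RLint (j - k)%:R (fun=> 1) t + RLint (al - k%:R) g t.
Let Nal' : N%:R < al. Proof. by case/andP: Nal. Qed.
Let tw : tower T N y F. Proof. exact: solution_tower. Qed.
Let c1 : continuous (fun _ : R => 1 : R). Proof. exact: continuous_fcst. Qed.
Let al0 : 0 < al. Proof. by apply: le_lt_trans Nal'. Qed.

Lemma solution_Ck : Ck T N y.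
Proof. exact: tower_Ck tw. Qed.

Lemma solution_init k : (k <= N)%N -> F k 0 = (k == j)%:R.
Proof.
move=> kN; rewrite /F [RLint (al - _) _ _]RLint_neg//; last first.
  by rewrite subr_gt0 (le_lt_trans _ Nal')// ler_nat.
by rewrite addr0 RLint_nat1_0 subn_eq0 -natrM mulnb -eqn_leq.
Qed.

Lemma solution_derive1n_cvg k : (k <= N)%N ->
  derive1n k y t @[t --> 0^'+] --> ((k == j)%:R : R).
Proof.
move=> kN; rewrite -solution_init//; have [cF _ _] := tw.
have : F k t @[t --> 0^'+] --> F k 0 by apply: cvg_at_right_filter; exact: cF.
apply: cvg_trans; apply: near_eq_cvg; near=> t; rewrite (tower_derive1n tw)//.
by apply/andP; split; near: t; [exact: nbhs_right_gt|exact: nbhs_right_lt].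
Unshelve. all: by end_near. Qed.

(** With initial data [k = j], the Taylor polynomial of degree [N] is exactly Phi_{j+1}. *)
Lemma solution_taylor_rem t : 0 <= t <= T ->
  taylor_rem T N.+1 y t = RLint al g t.
Proof.
move=> tT; have t0 : 0 <= t by case/andP: tT.
have T00 : 0 <= (0 : R) <= T by rewrite lexx ltW.
rewrite /taylor_rem (yE tT) (Phi_nat _ t0).
suff -> : \sum_(0 <= k < N.+1) derive_segn T k y 0 / k`!%:R * t ^+ k =
    RLint j%:R (fun=> 1) t.
  by move: (RLint _ _ _) (RLint _ _ _) => x z; rewrite addrAC subrr add0r.
rewrite (RLint_nat1 _ t0) big_mkord (bigD1 (Ordinal (jN : (j < N.+1)%N)))//=
  big1 => [|i ij].
  rewrite (tower_derive_segn T0 tw jN T00) (solution_init jN) eqxx mul1r addr0.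
  by rewrite mulrC.
have iN : (i <= N)%N by rewrite -ltnS.
rewrite (tower_derive_segn T0 tw iN T00) (solution_init iN).
rewrite (_ : (i == j :> nat) = false) ?mul0r//.
by apply: contraNF ij => /eqP e; apply/eqP/val_inj.
Qed.

Lemma solution_Caputo0 : Caputo_derivable T al y /\
  forall t, 0 < t < T -> Caputo T al y t = g t.
Proof.
have N1 : dorder al = N.+1.
  by apply: dorderE; rewrite -(natr1 N) addrK natr1.
rewrite /Caputo_derivable /Caputo N1; apply: (RLderivP N1) => // t tT.
have NA : 0 <= N.+1%:R - al by rewrite subr_ge0; case/andP: Nal.
have t0 : 0 <= t by case/andP: tT.
have e s : 0 <= s <= t -> taylor_rem T N.+1 y s = RLint al g s.
  by move=> /andP[s0 st]; rewrite solution_taylor_rem// s0 (le_trans st)//;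
    case/andP: tT.
by rewrite (eq_RLint NA t0 e) (RLint_semigroup _ NA (ltW al0) cg) subrK.
Qed.

(** As n <= N, Taylor's formula at order [n] brings the Caputo derivative to its classical form
    I^(n-b) y^(n). For j < n the derivative y^(n) has lost Phi_{j+1}, hence the indicator. *)
Lemma solution_Caputo b n : n%:R - 1 < b <= n%:R -> 0 <= b -> (n <= N)%N ->
  Caputo_derivable T b y /\ forall t, 0 < t < T ->
  Caputo T b y t = (n <= j)%:R * RLint (j%:R - b) (fun=>
    1) t + RLint (al - b) g t.
Proof.
move=> nb b0 nN; have N1 := dorderE nb; have [cF _ _] := tw.
have NA : 0 <= n%:R - b by rewrite subr_ge0; case/andP: nb.
have nal : n%:R <= al by rewrite (le_trans _ (ltW Nal'))// ler_nat.
have [h1 h2] : RLderivable T b (taylor_rem T n y) /\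
    forall t, 0 < t < T -> RLderiv b (taylor_rem T n y) t = RLint (n%:R - b)
      (F n) t.
  apply: (RLderivP N1) => //; first by apply: continuous_RLint => //; exact: cF.
  move=> t tT; have t0 : 0 <= t by case/andP: tT.
  have e s : 0 <= s <= t -> taylor_rem T n y s = RLint n%:R (F n) s.
    by move=> /andP[s0 st]; apply: (tower_taylor T0 tw nN);
      rewrite s0 (le_trans st)//; case/andP: tT.
  rewrite (eq_RLint NA t0 e) (RLint_semigroup _ NA (ler0n R n) (cF _ nN)).
  by rewrite (RLint_semigroup _ (ler0n R n) NA (cF _ nN)) addrC.
rewrite /Caputo_derivable /Caputo N1; split=> // t tT; rewrite h2//.
have r1 : continuous (RLint (j - n)%:R (fun=>
  1 : R)) by exact: continuous_RLint.
have rg : continuous (RLint (al - n%:R) g) by apply: continuous_RLint;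
  rewrite ?subr_ge0.
have aln : 0 <= al - n%:R by rewrite subr_ge0.
have rc : continuous (fun s => (n <= j)%:R * RLint (j - n)%:R (fun=> 1 : R) s).
  exact: continuous_fscale.
rewrite (RLintD _ NA rc rg) (RLintZ _ _ NA r1).
rewrite (RLint_semigroup _ NA (ler0n R _) c1) (RLint_semigroup _ NA aln cg).
have -> : n%:R - b + (al - n%:R) = al - b by ring.
case: (leqP n j) => nj; last by rewrite !mul0r.
suff -> : n%:R - b + (j - n)%:R = j%:R - b by [].
by rewrite natrB//; ring.
Qed.

Lemma solution_Calphak : Calphak T al N y.
Proof.
have [h1 h2] := solution_Caputo0; split => //; first exact: solution_Ck.
by exists g; split=> //; exact: continuous_subspaceT.
Qed.

End solution.

(** * Recovering a function from its Caputo derivative *)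

Section representation.
Variable R : realType.
Implicit Types (t T al : R) (g u z : R -> R).

Lemma RLint_1_inj T (u v : R -> R) t : 0 < T -> continuous u -> continuous v ->
  (forall s, 0 <= s <= T -> RLint 1 u s = RLint 1 v s) -> 0 <= t <= T ->
    u t = v t.
Proof.
move=> T0 cu cv uv; apply: eq_segment_closure => // s sT.
have [s0 _] := andP sT.
have [_ <-] := is_derive_RLint_1 cu s0; have [_ <-] := is_derive_RLint_1 cv s0.
apply: near_eq_derive; near=> x; apply: uv.
have /andP[x0 xT] : 0 < x < T by near: x; exact: near_itvoo.
by rewrite !ltW.
Unshelve. all: by end_near. Qed.

(* [RLint (N + 1 - al) u] has derivative [g]; applying [RLint (al - N)] turns
   this into [RLint 1 u = RLint 1 (RLint (al - N) g)]. *)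
Lemma RLderiv_inv T al (N : nat) u g t : 0 < T -> N%:R < al <= N.+1%:R ->
  continuous u -> u 0 = 0 -> continuous g ->
  (forall s, 0 < s < T -> is_derive s 1 (RLint (N.+1%:R - al) u) (g s)) ->
  0 <= t <= T -> u t = RLint (al - N%:R) g t.
Proof.
move=> T0 /andP[Nal alN] cu u0 cg dW.
have b0 : 0 <= N.+1%:R - al by rewrite subr_ge0.
have c0 : 0 <= al - N%:R by rewrite subr_ge0 ltW.
have cW : continuous (RLint (N.+1%:R - al) u) by exact: continuous_RLint.
have W0 : RLint (N.+1%:R - al) u 0 = 0.
  move: b0; rewrite le_eqVlt => /predU1P[<-|b0]; first by rewrite RLint0.
  exact: RLint_neg b0 (lexx 0).
have WE := FTC_RLint cW cg dW.
apply: RLint_1_inj => //; first exact: continuous_RLint.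
move=> s sT; have [s0 _] := andP sT.
have e : al - N%:R + (N.+1%:R - al) = 1 by rewrite -(natr1 N); ring.
rewrite -[in LHS]e -(RLint_semigroup _ c0 b0 cu).
rewrite (RLint_semigroup _ ler01 c0 cg)
  [1 + _]addrC -(RLint_semigroup _ c0 ler01 cg).
apply: eq_RLint => // x /andP[x0 xs].
rewrite WE ?W0 ?(add0r (RLint 1 g x))//.
by rewrite x0 (le_trans xs)//; case/andP: sT.
Qed.

(** Let u = z^(N) - z^(N)(0) and W = I^(N+1-al) u. By Taylor's formula the integral to be
    differentiated N + 1 times is I^N W, so the Caputo derivative is just W', and [RLderiv_inv]
    recovers [u] from it. *)
Lemma solution_representation T al (N j : nat) z : 0 < T ->
  N%:R < al <= N.+1%:R ->
  (j <= N)%N -> Calphak T al N z ->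
  (forall k, (k <= N)%N -> derive1n k z t @[t --> 0^'+] -->
    ((k == j)%:R : R)) ->
  exists2 g, continuous g &
    forall t, 0 <= t <= T -> z t = Phi j.+1%:R t + RLint al g t.
Proof.
move=> T0 Nal jN [Cz dz [g0 [cg0 g0E]]] iz.
have [Nal' alN] := andP Nal.
pose Z k := derive_segn T k z \o clamp T.
have tw : tower T N z Z by exact: Ck_tower.
have [cZ _ _] := tw.
have T00 : 0 <= (0 : R) <= T by rewrite lexx ltW.
(* Continuity of [Z k] turns the limits at 0+ of the interior derivatives into the one-sided
   derivatives at 0 of the Taylor polynomial. *)
have Z0 k : (k <= N)%N -> Z k 0 = (k == j)%:R.
  move=> kN; apply: (@cvg_unique _ (@norm_hausdorff _ R) (Z k x @[x --> 0^'+])).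
    by apply: cvg_at_right_filter; exact: cZ.
  have := iz k kN; apply: cvg_trans; apply: near_eq_cvg; near=> x.
  rewrite (tower_derive1n tw)//.
  by apply/andP; split; near: x; [exact: nbhs_right_gt|exact: nbhs_right_lt].
pose g := g0 \o clamp T.
have cg : continuous g by exact: continuous_comp_clamp.
have gE t : 0 < t < T -> g t = g0 t.
  by move=> /andP[t0 tT]; rewrite /g /= clamp_id// !ltW.
pose u t := Z N t + (- Z N 0) * 1.
have c1 : continuous (fun _ : R => 1 : R) by exact: continuous_fcst.
have cu : continuous u.
  by apply: continuous_fadd; [exact: cZ|exact: continuous_fscale].
have u0 : u 0 = 0 by rewrite /u mulr1 subrr.
have taylorE t : 0 <= t <= T -> taylor_rem T N.+1 z t = RLint N%:R u t.
  move=> tT; have [t0 _] := andP tT.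
  have cm : continuous (fun _ : R =>
    (- Z N 0) * 1 : R) by exact: continuous_fscale.
  rewrite (RLintD _ (ler0n R N) (cZ _ (leqnn N)) cm) (RLintZ _ _ (ler0n R N)
    c1).
  rewrite /taylor_rem big_nat_recr//= opprD addrA -/(taylor_rem T N z t).
  rewrite (tower_taylor T0 tw (leqnn N) tT) (tower_derive_segn T0 tw (leqnn N)
    T00).
  rewrite (RLint_nat1 _ t0); congr (_ + _); rewrite mulNr; congr (- _).
  by rewrite -mulrA [_^-1 * _]mulrC.
have b0 : 0 <= N.+1%:R - al by rewrite subr_ge0.
have N1 : dorder al = N.+1.
  by apply: dorderE; rewrite -(natr1 N) addrK natr1.
pose P := RLint (N.+1%:R - al) (taylor_rem T N.+1 z).
pose W := RLint (N.+1%:R - al) u.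
have cW : continuous W by exact: continuous_RLint.
have PE t : 0 <= t <= T -> P t = RLint N%:R W t.
  move=> tT; have [t0 _] := andP tT.
  have e s : 0 <= s <= t -> taylor_rem T N.+1 z s = RLint N%:R u s.
    by move=> /andP[s0 st]; apply: taylorE; rewrite s0 (le_trans st)//;
      case/andP: tT.
  rewrite /P (eq_RLint b0 t0 e) (RLint_semigroup _ b0 (ler0n R N) cu).
  by rewrite (RLint_semigroup _ (ler0n R N) b0 cu) addrC.
have twP := tower_RLint cW PE.
have WE t : 0 < t < T -> derive1n N P t = W t.
  by move=> tT; rewrite (tower_derive1n twP (leqnn N) tT) subnn RLint0.
have dW t : 0 < t < T -> is_derive t 1 W (g t).
  move=> tT; apply: (@near_eq_is_derive _ _ _ (derive1n N P)).
    by near=> x; rewrite WE//; near: x; exact: near_itvoo.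
  apply: DeriveDef.
    by have := dz N t; rewrite N1; apply.
  by rewrite (gE _ tT) -(g0E _ tT) /Caputo /RLderiv N1 derive1nS derive1E.
have uE t := RLderiv_inv (t := t) T0 Nal cu u0 cg dW.
exists g => // t tT; have [t0 tT'] := andP tT.
have c0 : 0 <= al - N%:R by rewrite subr_ge0 ltW.
have tE : taylor_rem T N.+1 z t = RLint al g t.
  rewrite (taylorE _ tT).
  have e s : 0 <= s <= t -> u s = RLint (al - N%:R) g s.
    by move=> /andP[s0 st]; apply: uE; rewrite s0 (le_trans st).
  rewrite (eq_RLint (ler0n R N) t0 e) (RLint_semigroup _ (ler0n R N) c0 cg).
  by congr (RLint _ g t); ring.
rewrite -tE /taylor_rem addrC -[LHS](subrK (Phi j.+1%:R t)); congr (_ + _).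
congr (_ - _); rewrite (Phi_nat _ t0) (RLint_nat1 _ t0).
rewrite big_mkord (bigD1 (Ordinal (jN : (j < N.+1)%N)))//= big1 => [|i ij].
  rewrite (tower_derive_segn T0 tw jN T00) (Z0 _ jN) eqxx mul1r addr0.
  by rewrite mulrC.
have iN : (i <= N)%N by rewrite -ltnS.
rewrite (tower_derive_segn T0 tw iN T00) (Z0 _ iN).
rewrite (_ : (i == j :> nat) = false) ?mul0r//.
by apply: contraNF ij => /eqP e; apply/eqP/val_inj.
Unshelve. all: by end_near. Qed.

End representation.

(** * The Volterra equation *)

Section uniform_series.
Variable R : realType.

(** Weierstrass's test with an explicit tail; it is this tail bound that is later pushed through [V]
    and the fractional integrals. *)
Lemma geometric_series_continuous (u : nat -> R -> R) (C : R) :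
  (forall k, continuous (u k)) -> (forall k t, `|u k t| <= C * 2^-1 ^+ k) ->
  exists2 g : R -> R, continuous g &
    forall N t, `|g t - \sum_(0 <= k < N) u k t| <= 2 * C * 2^-1 ^+ N.
Proof.
move=> cu uC.
have C0 : 0 <= C by have := le_trans (normr_ge0 _) (uC 0%N 0);
  rewrite expr0 mulr1.
pose S N t := \sum_(0 <= k < N) u k t.
have h1 : `|2^-1 : R| < 1 by rewrite ger0_norm// invf_lt1// ltr1n.
have dS n N t : (n <= N)%N -> `|S N t - S n t| <= 2 * C * 2^-1 ^+ n.
  move=> /subnK <-; move: (N - n)%N => d.
  (* Keeping the exact finite geometric sum makes the induction on [d] close. *)
  apply: (@le_trans _ _ (2 * C * (2^-1 ^+ n - 2^-1 ^+ (d + n)))); last first.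
    by rewrite ler_wpM2l ?mulr_ge0// lerBlDr lerDl exprn_ge0.
  elim: d => [|d IH]; first by rewrite !subrr normr0 mulr0.
  rewrite addSn /S big_nat_recr//= addrAC; apply: (le_trans (ler_normD _ _)).
  apply: (le_trans (lerD IH (uC _ t))); rewrite exprS le_eqVlt; apply/orP;
    left; apply/eqP.
  by field.
have cvgS t : cvg (S^~ t @ \oo).
  apply: (@normed_cvg _ _ (u^~ t)).
  apply: (series_le_cvg (v_ := geometric C 2^-1)) => [n|n|n|].
  - exact: normr_ge0.
  - by rewrite /geometric/= mulr_ge0// exprn_ge0.
  - exact: uC.
  - exact: is_cvg_geometric_series.
have bnd N t : `|lim (S^~ t @ \oo) - S N t| <= 2 * C * 2^-1 ^+ N.
  have hl : `|S n t - S N t| @[n --> \oo] --> `|lim (S^~ t @ \oo) - S N t|.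
    by apply: cvg_norm; apply: cvgB; [exact: cvgS|exact: cvg_cst].
  apply: (cvgr_to_le hl); near=> n; apply: dS; near: n; exact: nbhs_infty_ge.
exists (fun t => lim (S^~ t @ \oo)) => //.
  move=> t; apply/cvgrPdist_lt => e e0.
  have /cvgrPdist_lt/(_ (e / 3)) : 2 * C * 2^-1 ^+ n @[n --> \oo] --> (0 : R).
    exact: cvg_geometric.
  rewrite divr_gt0// => /(_ isT)[n _ /(_ n (leqnn n))/=].
  rewrite sub0r normrN ger0_norm ?mulr_ge0 ?exprn_ge0// => hn.
  have cS : continuous (S n).
    rewrite /S; elim: (n) => [|q IH].
      by rewrite (_ : (fun t => _) = fun=> 0);
        [exact: continuous_fcst|apply/funext => x; rewrite big_geq].
    rewrite (_ : (fun t => _) = fun t => \sum_(0 <= k < q) u k t + u q t).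
      exact: continuous_fadd.
    by apply/funext => x; rewrite big_nat_recr.
  have /cvgrPdist_lt/(_ (e / 3)) := cS t; rewrite divr_gt0// => /(_ isT).
  apply: filterS => x hx.
  set G := fun t => lim (S^~ t @ \oo).
  have -> : G t - G x = (G t - S n t) + (S n t - S n x) + (S n x - G x) by ring.
  apply: (le_lt_trans (ler_normD _ _)).
  have h3 : `|S n x - G x| < e / 3 by rewrite distrC;
    exact: le_lt_trans (bnd n x) hn.
  have h2 : `|G t - S n t| < e / 3 by exact: le_lt_trans (bnd n t) hn.
  have := ler_normD (G t - S n t) (S n t - S n x); lra.
Unshelve. all: by end_near. Qed.

End uniform_series.

Section Volterra.
Variable R : realType.
Variables (T : R) (m : nat) (alpha : nat -> R) (A : nat -> R -> R) (K b : R).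
Hypotheses (T0 : 0 < T) (cA : forall i, (1 <= i <= m)%N -> continuous (A i)).
Hypotheses (K0 : 0 <= K) (AK : forall i t, (1 <= i <= m)%N -> `|A i t| <= K).
Hypotheses (b0 : 0 < b) (bal : forall i, (1 <= i <= m)%N ->
  b <= alpha 0%N - alpha i).
Implicit Types (f h : R -> R) (t : R).
Let V := Vop m alpha A.

Let order_gt0 i : (1 <= i <= m)%N -> 0 < alpha 0%N - alpha i.
Proof. by move=> im; exact: lt_le_trans b0 (bal im). Qed.

Lemma continuous_sum_nat (P : pred nat) (F : nat -> R -> R) n :
  (forall i, (1 <= i <= n)%N -> P i -> continuous (F i)) ->
  continuous (fun t => \sum_(1 <= i < n.+1 | P i) F i t).
Proof.
elim: n => [|n IH] cF.
  rewrite (_ : (fun t => _) = fun=> 0); first exact: continuous_fcst.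
  by apply/funext => t; rewrite big_geq.
rewrite (_ : (fun t => _) = fun t => \sum_(1 <= i < n.+1 | P i) F i t
  + (if P n.+1 then F n.+1 t else 0)); last first.
  by apply/funext => t; rewrite big_mkcond big_nat_recr//= [in RHS]big_mkcond.
apply: continuous_fadd; first by apply: IH => i /andP[i1 iN]; apply: cF;
  rewrite i1 ltnW.
have [Pn|Pn] := boolP (P n.+1); last exact: continuous_fcst.
by apply: cF => //; rewrite ltnSn.
Qed.

Lemma continuous_Vop f : continuous f -> continuous (V f).
Proof.
move=> cf; apply: continuous_sum_nat => i im _.
by apply: continuous_fmul; [exact: cA|apply: continuous_RLint => //;
  exact/ltW/order_gt0].
Qed.

Lemma continuous_iter_Vop k f : continuous f -> continuous (iter k V f).
Proof. by move=> cf; elim: k => // k IH; rewrite iterS;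
  exact: continuous_Vop. Qed.

Lemma Vop_linear f h (c : R) t : continuous f -> continuous h ->
  V (fun s => f s + c * h s) t = V f t + c * V h t.
Proof.
move=> cf ch; rewrite /V /Vop mulr_sumr -big_split/=; apply: eq_big_nat => i im.
have o := ltW (order_gt0 im).
have cc : continuous (fun s => c * h s) by exact: continuous_fscale.
by rewrite (RLintD _ o cf cc) (RLintZ _ _ o ch) mulrDr mulrCA.
Qed.

Lemma eq_Vop (a : nat -> R -> R) f h t : 0 <= t ->
  (forall i, (1 <= i <= m)%N -> a i t = A i t) ->
  (forall s, 0 <= s <= t -> f s = h s) -> Vop m alpha a f t = V h t.
Proof.
move=> t0 aA fh; apply: eq_big_nat => i im.
by rewrite (aA _ im) (eq_RLint (ltW (order_gt0 im)) t0 fh).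
Qed.

(* The weight [expR (p * s)] turns the norm of [RLint c] into [p `^ (- c)],
   which tends to 0 with 1 / p. *)
Lemma Vop_contraction : exists2 p : R, 0 < p &
  forall f M t, continuous f -> 0 <= M ->
  (forall s, 0 <= s <= t -> `|f s| <= M * expR (p * s)) ->
  `|V f t| <= M / 2 * expR (p * t).
Proof.
(* The [m] terms contribute at most m K p^(-b) <= m K / L <= 1/2, and the added 1 keeps [L]
   positive. Taking p >= L^(1/b) gives p^(-b) <= 1/L, and p >= 1 gives p^(-c) <= p^(-b) for the
   orders c >= b. *)
pose L := 2 * (m%:R * K + 1).
have L0 : 0 < L by rewrite mulr_gt0// ltr_wpDl// mulr_ge0.
pose p := Num.max 1 (L `^ b^-1).
have p1 : 1 <= p by rewrite le_max lexx.
have p0 : 0 < p by exact: lt_le_trans p1.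
have pb : p `^ (- b) <= L^-1.
  rewrite powRN lef_pV2 ?posrE ?powR_gt0//.
  have {1}-> : L = (L `^ b^-1) `^ b.
    by rewrite -powRrM mulVf ?lt0r_neq0// powRr1// ltW.
  rewrite ge0_ler_powR ?nnegrE ?powR_ge0 ?(ltW b0) ?(ltW p0)//.
  by rewrite le_max lexx orbT.
exists p => // f M t cf M0 fM.
have E0 := expR_gt0 (p * t).
apply: (@le_trans _ _ (\sum_(1 <= i < m.+1) K * (M * L^-1 * expR (p * t)))).
  apply: (le_trans (ler_norm_sum _ _ _)); apply: ler_sum_nat => i im.
  rewrite normrM ler_pM// ?AK//.
  apply: (le_trans (RLint_bound (order_gt0 im) p0 M0 cf fM)).
  rewrite ler_pM2r// ler_wpM2l//; apply: le_trans pb.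
  by rewrite ler_powR// lerN2 bal.
rewrite sumr_const_nat subn1/= -[X in X <= _]mulr_natl.
rewrite (_ : m%:R * _ = (M * expR (p * t)) * (m%:R * K / L)); last by ring.
have -> : M / 2 * expR (p * t) = (M * expR (p * t)) * 2^-1 by ring.
rewrite ler_wpM2l ?mulr_ge0 ?expR_ge0// ler_pdivrMr// /L mulrA mulVf ?mul1r//.
by rewrite lerDl.
Qed.

Lemma Vop_iter_bound p f M t k :
  (forall f M t, continuous f -> 0 <= M ->
    (forall s, 0 <= s <= t -> `|f s| <= M * expR (p * s)) ->
    `|V f t| <= M / 2 * expR (p * t)) ->
  continuous f -> 0 <= M -> (forall s, 0 <= s <= t ->
    `|f s| <= M * expR (p * s)) ->
  0 <= t -> `|iter k V f t| <= M * 2^-1 ^+ k * expR (p * t).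
Proof.
move=> pV cf M0 fM; elim: k t fM => [|k IH] t fM t0.
  by rewrite expr0 mulr1 fM// t0 lexx.
rewrite iterS exprS (_ : M * (_ * _) = M * 2^-1 ^+ k / 2); last by ring.
apply: pV.
- exact: continuous_iter_Vop.
- by rewrite mulr_ge0// exprn_ge0.
- move=> s /andP[s0 st]; apply: IH => // x /andP[x0 xs].
  by apply: fM; rewrite x0 (le_trans xs).
Qed.

Let partial w N t := \sum_(0 <= k < N) (-1) ^+ k.+1 * iter k V w t.

Lemma continuous_partial w N : continuous w -> continuous (partial w N).
Proof.
move=> cw; elim: N => [|N IH].
  rewrite (_ : partial w 0 = fun=> 0); first exact: continuous_fcst.
  by apply/funext => t; rewrite /partial big_geq.
rewrite (_ : partial w N.+1 = fun t =>
  partial w N t + (-1) ^+ N.+1 * iter N V w t).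
  by apply: continuous_fadd => //; apply: continuous_fscale;
    exact: continuous_iter_Vop.
by apply/funext => t; rewrite /partial big_nat_recr.
Qed.

(** Stated for an abstract [L] because it serves both [V] and [RLint c]. *)
Lemma linear_partial (L : (R -> R) -> R -> R) w N t :
  (forall f h (c : R), continuous f -> continuous h ->
    L (fun s => f s + c * h s) t = L f t + c * L h t) ->
  continuous w ->
  L (partial w N) t = \sum_(0 <= k < N) (-1) ^+ k.+1 * L (iter k V w) t.
Proof.
move=> Ll cw; elim: N => [|N IH].
  have c0 : continuous (fun _ : R => 0 : R) by exact: continuous_fcst.
  (* Writing 0 as 0 + (-1) 0 extracts L 0 = L 0 - L 0 = 0 from the only linearity available. *)
  rewrite big_geq// (_ : partial w 0 = fun s => 0 + (-1) * 0); last first.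
    by apply/funext => s; rewrite /partial big_geq// mulr0 addr0.
  rewrite (Ll _ _ (-1) c0 c0); ring.
rewrite big_nat_recr//= -IH -(Ll _ _ _ (@continuous_partial w N cw)
  (@continuous_iter_Vop N w cw)).
by congr (L _ t); apply/funext => s; rewrite /partial big_nat_recr.
Qed.

Lemma Vop_partial w N t : continuous w ->
  partial w N.+1 t = - w t - V (partial w N) t.
Proof.
move=> cw; rewrite (linear_partial (L := V)) => [|f h c cf ch|//];
  last exact: Vop_linear.
rewrite /partial big_nat_recl//= expr1 mulN1r -sumrN; congr (_ + _).
by apply: eq_bigr => k _; rewrite exprS mulN1r mulNr.
Qed.

(** The Neumann series converges uniformly on [0, T]. Both the equation and termwise integration
    follow by applying the bounds for [V] and I^c to the tail; the last clause with c = alpha_0 is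
    the series of the theorem. *)
Lemma Volterra_solution w : continuous w -> exists g,
  [/\ continuous g,
      forall t, 0 <= t <= T -> g t = - w t - V g t
    & forall c t, 0 < c -> 0 <= t <= T ->
      \sum_(0 <= k < N) (-1) ^+ k.+1 * RLint c (iter k V w) t @[N --> \oo]
        --> RLint c g t].
Proof.
move=> cw; have [p p0 pV] := Vop_contraction.
have [M M0 wM] := continuous_bounded_segment T cw.
pose C := M * expR (p * T).
have C0 : 0 <= C by rewrite mulr_ge0// expR_ge0.
have wM' t s : t <= T -> 0 <= s <= t -> `|w s| <= M * expR (p * s).
  move=> tT /andP[s0 st]; apply: (le_trans (wM s _)).
    by rewrite s0 (le_trans st).
  by rewrite ler_peMr// -[leLHS]expR0 ler_expR mulr_ge0// ltW.
(* Clamping makes the single constant C = M e^(pT) valid on the whole line. *)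
pose u k t := (-1) ^+ k.+1 * iter k V w (clamp T t).
have cu k : continuous (u k).
  apply: continuous_fscale => t.
  apply: (@continuous_comp _ _ _ (clamp T) (iter k V w));
    first exact: continuous_clamp.
  exact: continuous_iter_Vop.
have uC k t : `|u k t| <= C * 2^-1 ^+ k.
  have /andP[t0 tT] := clamp_in t T0.
  rewrite normrM normrX normrN1 expr1n mul1r.
  apply: (le_trans (Vop_iter_bound k pV cw M0 (fun s => @wM' _ s tT) t0)).
  rewrite /C mulrAC ler_wpM2r ?exprn_ge0// ler_wpM2l// ler_expR.
  by rewrite ler_wpM2l// ltW.
have [g cg gS] := geometric_series_continuous cu uC.
have gP N t : 0 <= t <= T -> `|g t + (-1) * partial w N t| <= 2 * C * 2^-1 ^+ N.
  move=> tT; have := gS N t; rewrite mulN1r /partial /u; congr (`|_ - _| <= _).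
  by apply: eq_bigr => k _; rewrite clamp_id.
have cgP N : continuous (fun s => g s + (-1) * partial w N s).
  by apply: continuous_fadd => //; apply: continuous_fscale;
    exact: continuous_partial.
have gPe N t s : t <= T -> 0 <= s <= t ->
    `|g s + (-1) * partial w N s| <= 2 * C * 2^-1 ^+ N * expR (p * s).
  move=> tT /andP[s0 st]; apply: (le_trans (gP N s _)).
    by rewrite s0 (le_trans st).
  rewrite ler_peMr ?mulr_ge0 ?exprn_ge0//.
  by rewrite -[leLHS]expR0 ler_expR mulr_ge0// ltW.
have e0 D : D * 2^-1 ^+ n @[n --> \oo] --> (0 : R).
  by apply: cvg_geometric; rewrite ger0_norm// invf_lt1// ltr1n.
exists g; split => // [t tT|c t c0 tT].
  have [t0 tT'] := andP tT.
  (* With S_N the partial sums, the residual is (g - S_{N+1}) + V (g - S_N). The summands of [D]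
     bound these, by 2^-(N+1) <= 2^-N and by the contraction factor 1/2. *)
  pose D := 2 * C + 2 * C / 2 * expR (p * t).
  apply/eqP; rewrite -subr_eq0 -normr_le0; apply: (cvgr_to_ge (e0 D)).
  near=> N.
  have -> : g t - (- w t - V g t) = (g t + (-1) * partial w N.+1 t)
      + (V g t + (-1) * V (partial w N) t) by rewrite Vop_partial//; ring.
  rewrite -Vop_linear//; last exact: continuous_partial.
  apply: (le_trans (ler_normD _ _)).
  have h1 := gP N.+1 t tT.
  have N0 : 0 <= (2^-1 : R) ^+ N by rewrite exprn_ge0.
  have h2 := pV _ (2 * C * 2^-1 ^+ N) t (cgP N) _ (fun s => gPe N t s tT').
  have {}h2 := h2 (mulr_ge0 (mulr_ge0 (ler0n R 2) C0) N0).
  apply: (le_trans (lerD h1 h2)); rewrite /D (mulrDl (2 * C)) lerD//.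
    by rewrite exprS ler_wpM2l ?mulr_ge0// ler_piMl// invf_le1// ler1n.
  by rewrite le_eqVlt; apply/orP; left; apply/eqP; ring.
have Rl f h (d : R) : continuous f -> continuous h ->
    RLint c (fun s => f s + d * h s) t = RLint c f t + d * RLint c h t.
  move=> cf ch; have cc : continuous (fun s =>
    d * h s) by exact: continuous_fscale.
  by rewrite (RLintD _ (ltW c0) cf cc) (RLintZ _ _ (ltW c0) ch).
have [t0 tT'] := andP tT.
rewrite (_ : (fun N => _) = fun N => RLint c (partial w N) t); last first.
  by apply/funext => N; rewrite (linear_partial (L := RLint c)).
apply/cvgrPdist_le => e egt0.
have /cvgrPdist_le/(_ e egt0) := e0 (2 * C * (p `^ (- c) * expR (p * t))).
apply: filterS => N; rewrite sub0r normrN ger0_norm; last first.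
  by rewrite !mulr_ge0 ?powR_ge0 ?expR_ge0 ?exprn_ge0.
apply: le_trans.
have -> : RLint c g t - RLint c (partial w N) t =
    RLint c (fun s => g s + (-1) * partial w N s) t.
  by rewrite (Rl _ _ (-1) cg (@continuous_partial w N cw)) mulN1r.
have N0 : 0 <= 2 * C * (2^-1 : R) ^+ N by rewrite !mulr_ge0// exprn_ge0.
apply: (le_trans (RLint_bound c0 p0 N0 (cgP N) (fun s => gPe N t s tT'))).
by rewrite le_eqVlt; apply/orP; left; apply/eqP; ring.
Unshelve. all: by end_near. Qed.

(** The difference satisfies d = - V d, so iterating the contraction bounds it by a multiple of 2^-k
    for every [k]. *)
Lemma Volterra_unique w g1 g2 : continuous g1 -> continuous g2 ->
  (forall t, 0 <= t <= T -> g1 t = - w t - V g1 t) ->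
  (forall t, 0 <= t <= T -> g2 t = - w t - V g2 t) ->
  forall t, 0 <= t <= T -> g1 t = g2 t.
Proof.
move=> c1 c2 E1 E2; have [p p0 pV] := Vop_contraction.
pose d t := g1 t + (-1) * g2 t.
have cd : continuous d by apply: continuous_fadd => //;
  exact: continuous_fscale.
have dE t : 0 <= t <= T -> d t = - V d t.
  by move=> tT; rewrite Vop_linear// /d E1// E2//; ring.
have [M M0 dM] := continuous_bounded_segment T cd.
have bnd k t : 0 <= t <= T -> `|d t| <= M * 2^-1 ^+ k * expR (p * t).
  elim: k t => [|k IH] t tT.
    rewrite expr0 mulr1 (le_trans (dM _ tT))// ler_peMr//
      -[leLHS]expR0 ler_expR.
    by rewrite mulr_ge0 ?(ltW p0)//; case/andP: tT.
  rewrite dE// normrN exprS (_ : M * (_ * _) = M * 2^-1 ^+ k / 2); last by ring.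
  apply: pV => //; first by rewrite mulr_ge0// exprn_ge0.
  move=> s /andP[s0 st]; apply: IH; rewrite s0 (le_trans st)//.
  by case/andP: tT.
move=> t tT; apply/eqP; rewrite -subr_eq0 -normr_le0 -mulN1r -/(d t).
have e0 : M * expR (p * t) * 2^-1 ^+ n @[n --> \oo] --> (0 : R).
  by apply: cvg_geometric; rewrite ger0_norm// invf_lt1// ltr1n.
apply: (cvgr_to_ge e0); near=> k.
by rewrite mulrAC; exact: bnd.
Unshelve. all: by end_near. Qed.

End Volterra.

(** * The fundamental system *)

Lemma bigmin_mem (s : seq nat) (m : nat) : \big[minn/m]_(i <- s) i \in m :: s.
Proof.
elim: s => [|x s IH]; first by rewrite big_nil inE.
rewrite big_cons /minn; case: ifP => _; first by rewrite !inE eqxx orbT.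
by move: IH; rewrite !inE => /orP[->|->]//; rewrite !orbT.
Qed.

Lemma bigmin_le (s : seq nat) (m i : nat) : i \in s ->
  (\big[minn/m]_(i <- s) i <= i)%N.
Proof.
elim: s => // x s IH; rewrite inE big_cons => /predU1P[->|/IH h].
  exact: geq_minl.
by rewrite (leq_trans _ h)// geq_minr.
Qed.

Lemma uniform_bound (R : realType) (m : nat) (A : nat -> R -> R) :
  (forall i, (1 <= i <= m)%N -> exists K, forall t, `|A i t| <= K) ->
  exists2 K : R, 0 <= K & forall i t, (1 <= i <= m)%N -> `|A i t| <= K.
Proof.
elim: m => [|m IH] hA; first by exists 0 => // i t /andP[i1]; rewrite leqNgt i1.
have [i /andP[i1 im]|K K0 hK] := IH; first by apply: hA; rewrite i1 ltnW.
have [|L hL] := hA m.+1; first by rewrite leqnn.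
exists (Num.max K L) => [|i t /andP[i1]]; first by rewrite le_max K0.
rewrite leq_eqVlt => /predU1P[->|im]; first by rewrite le_max hL orbT.
by rewrite le_max hK ?i1.
Qed.

Section system.
Variables (R : realType) (T : R) (m : nat) (alpha : nat -> R)
    (n : nat -> nat) (a : nat -> R -> R).
Hypotheses (T_gt0 : 0 < T)
    (m_ge1 : (1 <= m)%N)
    (alpha_decr : forall i, (i < m)%N -> alpha i.+1 < alpha i)
    (alpha_ge0 : 0 <= alpha m)
    (n_def : forall i, (i <= m)%N -> (n i)%:R - 1 < alpha i <= (n i)%:R)
    (n0_gt_n1 : (n 1%N < n 0%N)%N)
    (a_cont : forall i, (1 <= i <= m)%N -> {within `[0, T], continuous (a i)})
    (H0_neq0 : Hset m alpha 0 <> [::]).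

Lemma alpha_nonincr i k : (i <= k <= m)%N -> alpha k <= alpha i.
Proof.
move=> /andP[/subnK <-]; elim: (k - i)%N => // d IH dm.
by rewrite addSn (le_trans (ltW (alpha_decr dm)))// IH// ltnW.
Qed.

Lemma alpha_i_ge0 i : (i <= m)%N -> 0 <= alpha i.
Proof. by move=> im; rewrite (le_trans alpha_ge0)// alpha_nonincr//
  im leqnn. Qed.

(** [n i] is the ceiling of [alpha i]; this matches the indicators n_i <= j with the sets H_j. *)
Lemma leq_order i j : (i <= m)%N -> (n i <= j)%N = (alpha i <= j%:R).
Proof.
move=> im; have /andP[n1 n2] := n_def im; apply/idP/idP => h.
  by rewrite (le_trans n2)// ler_nat.
have : (n i)%:R < j.+1%:R :> R by rewrite -natr1 -ltrBlDr (lt_le_trans n1).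
by rewrite ltr_nat ltnS.
Qed.

Lemma order_le1 i : (1 <= i <= m)%N -> (n i <= n 1)%N.
Proof.
move=> /andP[i1 im]; rewrite leq_order// (@le_trans _ _ (alpha 1))//.
  by rewrite alpha_nonincr// i1.
by have /andP[] := n_def m_ge1.
Qed.

(** Some index of H_0 has a nonpositive order, and [alpha m] is the smallest order. Hence [m] lies
    in every H_j. *)
Lemma alpha_m0 : alpha m <= 0.
Proof.
move: H0_neq0; rewrite /Hset; case E : [seq _ <- _ | _] => [//|i s] _.
have : i \in [seq i <- index_iota 1 m.+1 | 0 <= alpha i <=
  0] by rewrite E inE eqxx.
rewrite mem_filter mem_index_iota ltnS => /andP[/andP[_ ai] /andP[_ im]].
by rewrite (le_trans _ ai)// alpha_nonincr// im leqnn.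
Qed.

Lemma hmin_gt0 j : (1 <= hmin m alpha j)%N.
Proof.
have := bigmin_mem (Hset m alpha j) m; rewrite inE => /predU1P[|].
  by rewrite /hmin => ->.
by rewrite mem_filter mem_index_iota => /and3P[].
Qed.

(** The orders decrease and [m] lies in H_j, so H_j is a final segment of 1..m, described by its
    minimum. *)
Lemma hmin_leq i j : (1 <= i <= m)%N -> (hmin m alpha j <= i)%N = (n i <= j)%N.
Proof.
move=> /andP[i1 im]; rewrite leq_order//; apply/idP/idP => h; last first.
  by apply: bigmin_le; rewrite mem_filter alpha_i_ge0//
    h mem_index_iota i1 ltnS.
have mH : m \in Hset m alpha j.
  rewrite mem_filter mem_index_iota m_ge1 ltnSn alpha_ge0/=.
  by rewrite andbT (le_trans alpha_m0).
have : hmin m alpha j \in Hset m alpha j.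
  by have := bigmin_mem (Hset m alpha j) m; rewrite inE => /predU1P[|//];
    rewrite /hmin => ->.
rewrite mem_filter => /andP[/andP[_ hj] _]; apply: le_trans hj.
by rewrite alpha_nonincr// h.
Qed.

Let N := (n 0%N).-1.
Let NE : N.+1 = n 0%N. Proof. by rewrite prednK//
  (leq_ltn_trans _ n0_gt_n1). Qed.
Let n1N : (n 1 <= N)%N. Proof. by rewrite -ltnS NE. Qed.
Let Nal : N%:R < alpha 0%N <= N.+1%:R.
Proof. by have := n_def (leq0n m); rewrite -NE -(natr1 N) addrK natr1. Qed.

Let A i := a i \o clamp T.
Let cA i : (1 <= i <= m)%N -> continuous (A i).
Proof. by move=> im; apply: continuous_comp_clamp => //; exact: a_cont. Qed.
Let aA i t : 0 <= t <= T -> a i t = A i t.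
Proof. by move=> tT; rewrite /A /= clamp_id. Qed.

Let A_bound : exists2 K : R, 0 <= K & forall i t, (1 <= i <= m)%N ->
  `|A i t| <= K.
Proof.
apply: uniform_bound => i im; have [K _ hK] :=
  continuous_bounded_segment T (cA im).
exists K => t; have cT := clamp_in t T_gt0.
by have := hK _ cT; rewrite /A/= (clamp_id cT).
Qed.

Let b := alpha 0%N - alpha 1%N.
Let b0 : 0 < b. Proof. by rewrite subr_gt0 alpha_decr. Qed.
Let bal i : (1 <= i <= m)%N -> b <= alpha 0%N - alpha i.
Proof. by move=> im; rewrite lerB// alpha_nonincr. Qed.

Let al0 : 0 < alpha 0%N.
Proof. by case/andP: Nal => + _; apply: le_lt_trans. Qed.

Let V := Vop m alpha A.
(** Phi_{j+1-alpha_i} is replaced by an integral of 1, equal to it for t >= 0 and continuous on the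
    whole line. *)
Let w j t := \sum_(1 <= i < m.+1 | (n i <= j)%N)
  A i t * RLint (j%:R - alpha i) (fun=> 1) t.

Let cw j : continuous (w j).
Proof.
apply: continuous_sum_nat => i im nj; apply: continuous_fmul; first exact: cA.
apply: continuous_RLint; last exact: continuous_fcst.
by rewrite subr_ge0 -leq_order//; case/andP: im.
Qed.

(** The equivalence between h <= i and n_i <= j lets one proof cover both formulas, with h = h_j and
    with h = 1. *)
Lemma given_by_solution h j g : (1 <= h)%N ->
  (forall i, (1 <= i <= m)%N -> (h <= i)%N = (n i <= j)%N) ->
  (forall c t, 0 < c -> 0 <= t <= T ->
      \sum_(0 <= k < N) (-1) ^+ k.+1 * RLint c (iter k V (w j)) t @[N --> \oo]
        --> RLint c g t) ->
  forall t, 0 <= t <= T ->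
  given_by m alpha a h j (fun t => Phi j.+1%:R t + RLint (alpha 0%N) g t) t.
Proof.
move=> h1 hE gS t tT; rewrite /given_by.
have wE s : 0 <= s <= T ->
    \sum_(h <= i < m.+1) a i s * Phi (j.+1%:R - alpha i) s = w j s.
  move=> sT; rewrite /w (big_nat_widenl h 1)//=.
  rewrite big_nat_cond [RHS]big_nat_cond; apply: eq_big => [i|i /andP[im hi]].
    by case: (boolP (1 <= i < m.+1)%N) => //= im; rewrite hE.
  have jai : 0 <= j%:R - alpha i.
    by rewrite subr_ge0 -leq_order -?hE//; case/andP: im.
  have [s0 _] := andP sT; rewrite (aA _ sT); congr (_ * _).
  by rewrite -(PhiE jai s0) -(natr1 j); congr Phi; ring.
have iE k s : 0 <= s <= T ->
    iter k (Vop m alpha a) (fun s =>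
      \sum_(h <= i < m.+1) a i s * Phi (j.+1%:R - alpha i) s) s =
    iter k V (w j) s.
  elim: k s => [|k IH] s sT; first exact: wE.
  have [s0 sT'] := andP sT; rewrite !iterS; apply: (eq_Vop b0 bal s0).
    by move=> i _; exact: aA.
  by move=> x /andP[x0 xs]; apply: IH; rewrite x0 (le_trans xs).
have := gS _ _ al0 tT => gt; apply: cvgD; first exact: cvg_cst.
rewrite (_ : (fun N => _) = fun N =>
  \sum_(0 <= k < N) (-1) ^+ k.+1 * RLint (alpha 0%N) (iter k V (w j)) t)//.
apply/funext => q; apply: eq_big_nat => k _; rewrite /sol_term; congr (_ * _).
have [t0 tT'] := andP tT; apply: (eq_RLint (ltW al0) t0) => s /andP[s0 st].
by apply: iE; rewrite s0 (le_trans st).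
Qed.

Let n_leN i : (1 <= i <= m)%N -> (n i <= N)%N.
Proof. by move=> im; exact: leq_trans (order_le1 im) n1N. Qed.

Lemma sum_Caputo j g y : (j <= N)%N -> continuous g ->
  (forall t, 0 <= t <= T -> y t = Phi j.+1%:R t + RLint (alpha 0%N) g t) ->
  forall t, 0 < t < T ->
  \sum_(1 <= i < m.+1) a i t * Caputo T (alpha i) y t = w j t + V g t.
Proof.
move=> jN cg yE t tT; rewrite /w /V /Vop [X in X + _]big_mkcond -big_split/=;
  apply: eq_big_nat => i im.
have im' : (i <= m)%N by case/andP: im.
have [_ CE] := solution_Caputo T_gt0 Nal jN cg yE (n_def im')
  (alpha_i_ge0 im') (n_leN im).
rewrite (CE _ tT) aA; last by case/andP: tT => /ltW-> /ltW->.
by rewrite mulrDr; congr (_ + _); case: ifP => _; rewrite ?mul1r// mul0r mulr0.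
Qed.

(** Equation (E) holds on ]0, T[ only; both sides being continuous in terms of [g], it extends to
    [0, T], where Volterra uniqueness is available. *)
Lemma solution_iff j g y : (j <= N)%N -> continuous g ->
  (forall t, 0 <= t <= T -> y t = Phi j.+1%:R t + RLint (alpha 0%N) g t) ->
  is_solution T m alpha a y <-> forall t, 0 <= t <= T -> g t = - w j t - V g t.
Proof.
move=> jN cg yE; have SC := sum_Caputo jN cg yE.
have [d0 C0] := solution_Caputo0 T_gt0 Nal jN cg yE.
split=> [[_ E] t tT|gE].
  apply: (eq_segment_closure T_gt0 (g := fun t => - w j t - V g t)) tT => //.
    move=> s; apply: cvgB; first by apply: cvgN; exact: cw.
    exact: (continuous_Vop cA b0 bal).
  by move=> s sT; rewrite -(C0 _ sT) (E _ sT) (SC _ sT) opprD.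
split=> [[|i] im|t tT]; first exact: d0.
  have im' : (1 <= i.+1 <= m)%N by rewrite im.
  by have [] := solution_Caputo T_gt0 Nal jN cg yE (n_def im) (alpha_i_ge0 im)
    (n_leN im').
rewrite (C0 _ tT) (SC _ tT) gE ?opprD//.
by case/andP: tT => /ltW-> /ltW->.
Qed.

Lemma fundamental_system :
  exists y : 'I_(n 0%N) -> R -> R,
    [/\ (forall j, Calphak T (alpha 0%N) (n 0%N).-1 (y j)) /\
          canonical_system T m alpha a y,
        (forall z : 'I_(n 0%N) -> R -> R,
          (forall j, Calphak T (alpha 0%N) (n 0%N).-1 (z j)) ->
          canonical_system T m alpha a z ->
          forall j t, 0 <= t <= T -> z j t = y j t),
        (forall (j : 'I_(n 0%N)) t, (j < n 1%N)%N -> 0 <= t <= T ->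
          given_by m alpha a (hmin m alpha j) j (y j) t)
      & (forall (j : 'I_(n 0%N)) t, (n 1%N <= j)%N -> 0 <= t <= T ->
          given_by m alpha a 1 j (y j) t)].
Proof.
have [K K0 AK] := A_bound.
have jN (j : 'I_(n 0%N)) : (j <= N)%N by rewrite -ltnS NE.
have kN (k : 'I_(n 0%N)) : (k <= N)%N by rewrite -ltnS NE.
(* The Volterra equation is solved for each [j] with forcing [w j]; these [g j] are the Caputo
   derivatives of the system. *)
have [g gP] := choice (fun j : nat =>
  Volterra_solution T_gt0 cA K0 AK b0 bal (@cw j)).
have cg j : continuous (g j) by have [] := gP j.
have gE j t : 0 <= t <= T -> g j t = - w j t - V (g j)
  t by have [_ + _] := gP j; apply.
pose y (j : 'I_(n 0%N)) t := Phi j.+1%:R t + RLint (alpha 0%N) (g j) t.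
have yE (j : 'I_(n 0%N)) t : 0 <= t <= T ->
  y j t = Phi j.+1%:R t + RLint (alpha 0%N) (g j) t by [].
exists y; split.
- split=> [j|]; first exact: (solution_Calphak T_gt0 Nal (jN j) (cg j) (yE j)).
  split=> [j|k j]; first by apply/(solution_iff (jN j) (cg j) (yE j)) => t;
    exact: gE.
  exact: (solution_derive1n_cvg T_gt0 Nal (jN j) (cg j) (yE j) (kN k)).
- move=> z Cz [sz iz] j t tT.
  have iz' k : (k <= N)%N -> derive1n k (z j) s @[s --> 0^'+] -->
    ((k == j)%:R : R).
    by rewrite -ltnS NE => kn; exact: (iz (Ordinal kn) j).
  have [f cf zE] := solution_representation T_gt0 Nal (jN j) (Cz j) iz'.
  have fE := (solution_iff (jN j) cf zE).1 (sz j).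
  have fg := Volterra_unique K0 AK b0 bal cf (cg j) fE (@gE j).
  rewrite zE// yE//; congr (_ + _); have [t0 tT'] := andP tT.
  apply: (eq_RLint (ltW al0) t0) => s /andP[s0 st].
  by apply: fg; rewrite s0 (le_trans st).
- move=> j t jn1 tT; have [_ _ gS] := gP j.
  apply: (given_by_solution (hmin_gt0 j) _ gS tT) => i im.
  exact: hmin_leq.
- move=> j t n1j tT; have [_ _ gS] := gP j.
  (* For j >= n_1 every n_i <= n_1 <= j, so no index is cut off and the sum starts at 1. *)
  apply: (given_by_solution (leqnn 1) _ gS tT) => i im.
  by rewrite (leq_trans (order_le1 im) n1j); case/andP: im.
Qed.

End system.

Unset Implicit Arguments.

Theorem theorem2 (R : realType) (T : R) (m : nat) (alpha : nat -> R)
    (n : nat -> nat) (a : nat -> R -> R)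
    (T_gt0 : 0 < T)
    (m_ge1 : (1 <= m)%N)
    (alpha_decr : forall i, (i < m)%N -> alpha i.+1 < alpha i)
    (alpha_ge0 : 0 <= alpha m)
    (n_def : forall i, (i <= m)%N -> (n i)%:R - 1 < alpha i <= (n i)%:R)
    (n0_gt_n1 : (n 1%N < n 0%N)%N)
    (a_cont : forall i, (1 <= i <= m)%N -> {within `[0, T], continuous (a i)})
    (H0_neq0 : Hset m alpha 0 <> [::]) :
  exists y : 'I_(n 0%N) -> R -> R,
    [/\ (forall j, Calphak T (alpha 0%N) (n 0%N).-1 (y j)) /\
          canonical_system T m alpha a y,
        (forall z : 'I_(n 0%N) -> R -> R,
          (forall j, Calphak T (alpha 0%N) (n 0%N).-1 (z j)) ->
          canonical_system T m alpha a z ->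
          forall j t, 0 <= t <= T -> z j t = y j t),
        (forall (j : 'I_(n 0%N)) t, (j < n 1%N)%N -> 0 <= t <= T ->
          given_by m alpha a (hmin m alpha j) j (y j) t)
      & (forall (j : 'I_(n 0%N)) t, (n 1%N <= j)%N -> 0 <= t <= T ->
          given_by m alpha a 1 j (y j) t)].
Proof. exact: fundamental_system. Qed.
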